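(* Let $Q$ be an $n$-qubit stabilizer code with $k\ge 1$ logical qubits that is free of trivially encoded qubits. Then, for every choice of logical Pauli operators of $Q$ and every logical qubit $s\in\{1,\dots,k\}$, the full automorphism group $\mathrm{Aut}(Q)$ is not an encoded computationally universal set of gates for logical qubit $s$.
   Context: The $n$-qubit Pauli group $\mathcal G_n$ consists of all operators $\alpha R_1\otimes\cdots\otimes R_n$ with $\alpha\in\{\pm1,\pm i\}$ and $R_i\in\{I,X,Y,Z\}$. A stabilizer $\mathcal S$ is an abelian subgroup of $\mathcal G_n$ not containing $-I$; the stabilizer code is $Q=\{|\psi\rangle\in(\mathbb C^2)^{\otimes n}: R|\psi\rangle=|\psi\rangle\ \forall R\in\mathcal S\}$, of dimension $2^k$ where $|\mathcal S|=2^{n-k}$, and $P_Q$ is the orthogonal projector onto $Q$. $\mathcal C(\mathcal S)$ is the set of elements of $\mathcal G_n$ commuting with all of $\mathcal S$. A choice of logical Pauli operators is a choice of (Hermitian) $\bar X_i,\bar Z_i\in\mathcal C(\mathcal S)$, $i=1,\dots,k$, which satisfy the commutation relations of $X_i,Z_i\in\mathcal G_k$ and whose classes (with scalars) generate $\mathcal C(\mathcal S)/\mathcal S\cong\mathcal G_k$; it identifies $Q$ with $(\mathbb C^2)^{\otimes k}$, the $s$-th factor being logical qubit $s$. $Q$ is free of trivially encoded qubits if for each $j\in\{1,\dots,n\}$ some element of $\mathcal S$ has $j$-th tensor factor different from $I$. The logical gates are $\mathbb V(Q)=\{U\in SU(2^{n}) : [U,P_Q]=0\}$. For $\pi\in S_n$,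 $P_\pi$ is the unitary $P_\pi|\psi_1\psi_2\dots\psi_n\rangle=|\psi_{\pi(1)}\psi_{\pi(2)}\dots\psi_{\pi(n)}\rangle$. The full automorphism group $\mathrm{Aut}(Q)$ is the group of all elements of $\mathbb V(Q)$ of the form $P_\pi U$ with $\pi\in S_n$ and $U=U_1\otimes\cdots\otimes U_n$ a local (single-qubit tensor product) unitary. A set $A\subseteq\mathbb V(Q)$ is encoded computationally universal for logical qubit $s$ (single block) if for every $U\in\mathbb V(Q)$ whose restriction to $Q$ acts as some $W\in SU(2)$ on logical qubit $s$ and as the identity on all other logical qubits, and for every $\epsilon>0$, there are $V_1,\dots,V_\eta\in A$ with $\|UP_Q-V_1V_2\cdots V_\eta P_Q\|<\epsilon$ (operator norm). *)

(* Defs.v *)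
From mathcomp Require Import all_boot all_order all_algebra.
From mathcomp Require Import boolp classical_sets cardinality reals.
From mathcomp Require Import perm spectral complex.

Set Implicit Arguments.
Unset Strict Implicit.
Unset Printing Implicit Defensive.

Import Order.TTheory GRing.Theory Num.Theory.

Local Open Scope classical_set_scope.
Local Open Scope sesquilinear_scope.
Local Open Scope ring_scope.

(* The computational basis of (C^2)^{\otimes n} is labelled by
   {ffun 'I_n -> 'I_2}; matrices are indexed through enum_val / enum_rank. *)
Definition qdim (n : nat) : nat := #|{ffun 'I_n -> 'I_2}|.

Lemma qdimE n : qdim n = (2 ^ n)%N.
Proof. by rewrite /qdim card_ffun !card_ord. Qed.

Definition label n (a : 'I_(qdim n)) : {ffun 'I_n -> 'I_2} := enum_val a.

Section Operators.
Variable R : realType.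
Local Notation C := R[i].

Definition tens n (U : 'I_n -> 'M[C]_2) : 'M[C]_(qdim n) :=
  \matrix_(a, b) \prod_(j < n) U j (label a j) (label b j).

Definition on_site n (s : 'I_n) (W : 'M[C]_2) : 'M[C]_(qdim n) :=
  tens (fun j => if j == s then W else 1%:M).

(* The matrix of |x_1 ... x_n> |-> |x_{pi 1} ... x_{pi n}> *)
Definition permute_qubits n (pi : 'S_n) : 'M[C]_(qdim n) :=
  \matrix_(a, b) (label a == [ffun j => label b (pi j)])%:R.

Definition special_unitary d (U : 'M[C]_d) : Prop :=
  U \is unitarymx /\ \det U = 1.

Definition ket_norm d (psi : 'cV[C]_d) : R :=
  Num.sqrt (\sum_(a < d) Normc.normc (psi a 0) ^+ 2).

Definition op_norm d (M : 'M[C]_d) : R :=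
  sup [set ket_norm (M *m psi) | psi in [set psi : 'cV[C]_d | ket_norm psi <= 1]].

Definition is_orthogonal_projector d (Q : set 'cV[C]_d) (P : 'M[C]_d) : Prop :=
  [/\ P *m P = P, P^t* = P & range (fun psi : 'cV[C]_d => P *m psi) = Q].

(* Meaningful when Q is a subspace, in which case the projector is unique. *)
Definition orthogonal_projector d (Q : set 'cV[C]_d) : 'M[C]_d :=
  xget 0 [set P | is_orthogonal_projector Q P].

Definition mx_group d (H : set 'M[C]_d) : Prop :=
  [/\ H 1%:M,
      forall A B, H A -> H B -> H (A *m B)
    & forall A, H A -> H (invmx A)].

Definition mx_generated d (G : set 'M[C]_d) : set 'M[C]_d :=
  smallest (@mx_group d) G.

Inductive pauli_letter := PI | PX | PY | PZ.

Definition pauli_mx (p : pauli_letter) : 'M[C]_2 :=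
  match p with
  | PI => 1%:M
  | PX => \matrix_(i, j) (i != j)%:R
  | PY => \matrix_(i, j)
            (if (i < j)%N then - 'i else if (j < i)%N then 'i else 0)
  | PZ => \matrix_(i, j) (if i == j then (-1) ^+ i else 0)
  end.

Definition phases : seq C := [:: 1; -1; 'i; - 'i].

Definition pauli_string n (r : 'I_n -> pauli_letter) : 'M[C]_(qdim n) :=
  tens (fun j => pauli_mx (r j)).

Definition pauli_group n : set 'M[C]_(qdim n) :=
  [set A | exists alpha r, alpha \in phases /\ A = alpha *: pauli_string r].

Section Code.
Variables (n : nat) (S : set 'M[C]_(qdim n)).

Definition stabilizer : Prop :=
  [/\ S `<=` @pauli_group n, mx_group S,
      forall A B, S A -> S B -> A *m B = B *m A
    & ~ S (- 1%:M)].

Definition codespace : set 'cV[C]_(qdim n) :=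
  [set psi | forall A, S A -> A *m psi = psi].

Definition code_projector : 'M[C]_(qdim n) := orthogonal_projector codespace.

Definition free_of_trivially_encoded_qubits : Prop :=
  forall j : 'I_n, exists alpha (r : 'I_n -> pauli_letter),
    [/\ alpha \in phases, S (alpha *: pauli_string r) & r j <> PI].

Definition pauli_centralizer : set 'M[C]_(qdim n) :=
  [set A | pauli_group A /\ forall B, S B -> A *m B = B *m A].

(* The last clause says that the classes of the Xb i, Zb i and of the phases
   generate the quotient of pauli_centralizer by S. *)
Definition logical_paulis k (Xb Zb : 'I_k -> 'M[C]_(qdim n)) : Prop :=
  [/\ forall i, [/\ pauli_centralizer (Xb i), pauli_centralizer (Zb i),
                    (Xb i)^t* = Xb i & (Zb i)^t* = Zb i],
      forall i j, Xb i *m Xb j = Xb j *m Xb i,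
      forall i j, Zb i *m Zb j = Zb j *m Zb i,
      forall i j, Xb i *m Zb j = (-1) ^+ (i == j) *: (Zb j *m Xb i)
    & pauli_centralizer =
        mx_generated (S `|` [set alpha%:M | alpha in [set` phases]]
                        `|` range Xb `|` range Zb)].

(* Identification of (C^2)^{\otimes k} with the code space, matching the
   Paulis X_i, Z_i of the k factors with Xb i, Zb i: an isometry onto the code
   space, determined by Xb and Zb up to a global phase. *)
Definition logical_encoding k (Xb Zb : 'I_k -> 'M[C]_(qdim n))
    (E : 'M[C]_(qdim n, qdim k)) : Prop :=
  [/\ E^t* *m E = 1%:M,
      range (fun phi : 'cV[C]_(qdim k) => E *m phi) = codespace,
      forall i, Xb i *m E = E *m on_site i (pauli_mx PX)
    & forall i, Zb i *m E = E *m on_site i (pauli_mx PZ)].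

Definition acts_on_logical_qubit k (Xb Zb : 'I_k -> 'M[C]_(qdim n)) (s : 'I_k)
    (U : 'M[C]_(qdim n)) (W : 'M[C]_2) : Prop :=
  exists2 E, logical_encoding Xb Zb E & U *m E = E *m on_site s W.

Definition logical_gates : set 'M[C]_(qdim n) :=
  [set U | special_unitary U /\ U *m code_projector = code_projector *m U].

Definition automorphism_group : set 'M[C]_(qdim n) :=
  [set V | logical_gates V /\
     exists (pi : 'S_n) (U : 'I_n -> 'M[C]_2),
       (forall j, U j \is unitarymx) /\ V = permute_qubits pi *m tens U].

Definition encoded_computationally_universal k
    (Xb Zb : 'I_k -> 'M[C]_(qdim n)) (s : 'I_k) (A : set 'M[C]_(qdim n)) : Prop :=
  A `<=` logical_gates /\
  forall (U : 'M[C]_(qdim n)) (W : 'M[C]_2),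
    logical_gates U -> special_unitary W ->
    acts_on_logical_qubit Xb Zb s U W ->
    forall eps : R, 0 < eps ->
    exists (eta : nat) (V : 'I_eta -> 'M[C]_(qdim n)),
      (forall l, A (V l)) /\
      op_norm (U *m code_projector
               - (\big[mulmx/1%:M]_(l < eta) V l) *m code_projector) < eps.

End Code.
End Operators.

(* Main.v *)
(* An automorphism V = P_pi U has a power (with exponent |S_n|) that is a local unitary, and by
   Dirichlet's theorem a further power, bounded independently of V, whose single-site factors
   are so close to scalars that the operator is a scalar times exp(iH), with H a sum of
   single-site Hermitian operators and the spectrum of H of diameter less than 2 pi. Then exp(iH)
   and H have the same commutant, so the projector P of the code commutes with H. Compressed by P,
   a single-site Pauli operator vanishes if it anticommutes with an element of the stabilizer;
   since every site is touched by some stabilizer element, at most one Pauli letter per site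
   survives, so all compressions of single-site operators commute, and hence so do the operators
   exp(iH) P. Consequently there is one exponent q > 0 such that (V P)^q and (V' P)^q commute for
   any two products V, V' of automorphisms. If these were dense in the gates on logical qubit s,
   then W^q and W'^q would commute for any two commutators W, W' of 2 x 2 unitaries, which fails
   for suitably chosen W, W'. *)

Require Import Defs.
From mathcomp Require Import all_boot all_order all_algebra.
From mathcomp Require Import boolp classical_sets cardinality reals.
From mathcomp Require Import perm spectral complex.
From mathcomp Require Import fingroup cyclic archimedean.
From mathcomp Require trigo.
From mathcomp Require Import ring lra.
Import Order.TTheory GRing.Theory Num.Theory.
Local Open Scope classical_set_scope.
Local Open Scope ring_scope.

Set Implicit Arguments.
Unset Strict Implicit.
Unset Printing Implicit Defensive.

(** * Tensor products and Pauli operators *)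

Section TensorProducts.
Local Open Scope sesquilinear_scope.
Variable R : realType.
Local Notation C := R[i].

Lemma sum_label {V : nmodType} n (F : {ffun 'I_n -> 'I_2} -> V) :
  \sum_(a < qdim n) F (label a) = \sum_f F f.
Proof.
rewrite [RHS](reindex (fun a : 'I_(qdim n) => label a)) //=.
apply: onW_bij; exists enum_rank; [exact: enum_valK | exact: enum_rankK].
Qed.

Lemma label_inj n : injective (@label n).
Proof. exact: enum_val_inj. Qed.

Lemma tens_mul n (U V : 'I_n -> 'M[C]_2) :
  tens U *m tens V = tens (fun j => U j *m V j).
Proof.
apply/matrixP => a b; rewrite !mxE.
under [RHS]eq_bigr do rewrite mxE.
rewrite bigA_distr_bigA /= -sum_label.
by apply: eq_bigr => c _; rewrite !mxE -big_split.
Qed.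

Lemma eq_tens n (U V : 'I_n -> 'M[C]_2) : U =1 V -> tens U = tens V.
Proof. by move=> eqUV; apply/matrixP => a b; rewrite !mxE; apply: eq_bigr => j _; rewrite eqUV. Qed.

(** A product of zeros and ones is the indicator of a conjunction. The identity and the one-site bit
    flip are both of this kind. *)
Lemma tens_delta n (U : 'I_n -> 'M[C]_2) (P : 'I_n -> 'I_2 -> 'I_2 -> bool) :
  (forall j x y, U j x y = (P j x y)%:R) ->
  forall a b, tens U a b = [forall j, P j (label a j) (label b j)]%:R.
Proof.
move=> UE a b; rewrite mxE; under eq_bigr do rewrite UE.
have [/forallP allP|] := boolP [forall j, P j (label a j) (label b j)].
  by rewrite big1 // => j _; rewrite allP.
by rewrite negb_forall => /existsP[j /negbTE nPj]; rewrite (bigD1 j) //= nPj mul0r.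
Qed.

Lemma tens1 n : tens (fun _ : 'I_n => 1%:M) = 1%:M :> 'M[C]_(qdim n).
Proof.
apply/matrixP => a b; rewrite (@tens_delta _ _ (fun _ x y => x == y)).
  rewrite mxE -(inj_eq (@label_inj n)); congr (_%:R); congr nat_of_bool.
  by apply/forallP/eqP => [h|->//]; apply/ffunP => j; apply/eqP.
by move=> j x y; rewrite mxE.
Qed.

Lemma tens_scale n (c : 'I_n -> C) (U : 'I_n -> 'M[C]_2) :
  tens (fun j => c j *: U j) = (\prod_j c j) *: tens U.
Proof.
apply/matrixP => a b; rewrite !mxE -big_split /=.
by apply: eq_bigr => j _; rewrite mxE.
Qed.

Lemma tens_adj n (U : 'I_n -> 'M[C]_2) : (tens U)^t* = tens (fun j => (U j)^t*).
Proof.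
apply/matrixP => a b; rewrite !mxE rmorph_prod.
by apply: eq_bigr => j _; rewrite !mxE.
Qed.

Lemma tens_unitary n (U : 'I_n -> 'M[C]_2) :
  (forall j, U j \is unitarymx) -> tens U \is unitarymx.
Proof.
move=> uU; apply/unitarymxP; rewrite tens_adj tens_mul -tens1.
by apply: eq_tens => j; apply/unitarymxP.
Qed.

Lemma trace_tens n (U : 'I_n -> 'M[C]_2) : \tr (tens U) = \prod_j \tr (U j).
Proof.
rewrite /mxtrace bigA_distr_bigA /= -sum_label.
by apply: eq_bigr => a _; rewrite mxE.
Qed.

Lemma on_siteD n (s : 'I_n) (A B : 'M[C]_2) :
  on_site s (A + B) = on_site s A + on_site s B.
Proof.
apply/matrixP => a b; rewrite !mxE !(bigD1 s (P := predT)) //= eqxx !mxE.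
by rewrite mulrDl; congr (_ * _ + _ * _); apply: eq_bigr => j /negbTE->.
Qed.

Lemma on_siteZ n (s : 'I_n) c (A : 'M[C]_2) : on_site s (c *: A) = c *: on_site s A.
Proof.
apply/matrixP => a b; rewrite !mxE !(bigD1 s (P := predT)) //= eqxx !mxE mulrA.
by congr (_ * _); apply: eq_bigr => j /negbTE->.
Qed.

Lemma on_site_mul n (s : 'I_n) (A B : 'M[C]_2) :
  on_site s A *m on_site s B = on_site s (A *m B).
Proof.
by rewrite tens_mul; apply: eq_tens => j; case: (j == s); rewrite ?mulmx1.
Qed.

Lemma on_site1 n (s : 'I_n) : on_site s 1%:M = 1%:M :> 'M[C]_(qdim n).
Proof. by rewrite -tens1; apply: eq_tens => j; case: (j == s). Qed.

Lemma on_site_adj n (s : 'I_n) (A : 'M[C]_2) : (on_site s A)^t* = on_site s (A^t*).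
Proof.
by rewrite tens_adj; apply: eq_tens => j; case: (j == s); rewrite // trmx1 map_mx1.
Qed.

(** The entries of the one-site matrix are recovered at the labels [f x] that vanish away from
    [s]. *)
Lemma on_site_inj n (s : 'I_n) : injective (@on_site R n s).
Proof.
move=> A B eqAB; apply/matrixP => x y.
pose f z : {ffun 'I_n -> 'I_2} := [ffun j => if j == s then z else 0].
have onE (M : 'M[C]_2) : on_site s M (enum_rank (f x)) (enum_rank (f y)) = M x y.
  rewrite mxE (bigD1 s) //= eqxx /label !enum_rankK !ffunE eqxx big1 ?mulr1 //.
  by move=> j /negbTE nj; rewrite nj !ffunE nj mxE.
by rewrite -!onE eqAB.
Qed.

Lemma on_site_comm n (s t : 'I_n) (A B : 'M[C]_2) : s != t ->
  on_site s A *m on_site t B = on_site t B *m on_site s A.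
Proof.
move=> neq; rewrite !tens_mul; apply: eq_tens => j.
have [->|_] := eqVneq j s; first by rewrite (negbTE neq) mulmx1 mul1mx.
by case: (j == t); rewrite ?mulmx1 ?mul1mx.
Qed.

Lemma permute_qubits1 n : permute_qubits R (1%g : 'S_n) = 1%:M.
Proof.
apply/matrixP => a b; rewrite !mxE -(inj_eq (@label_inj n)); congr (_ == _)%:R.
by apply/ffunP => j; rewrite ffunE perm1.
Qed.

Lemma permute_qubitsM n (p q : 'S_n) :
  permute_qubits R p *m permute_qubits R q = permute_qubits R (p * q)%g.
Proof.
apply/matrixP => a b; rewrite !mxE.
pose c := enum_rank [ffun j => label b (q j)].
rewrite (bigD1 c) //= big1 ?addr0 => [|d].
  rewrite !mxE /label enum_rankK eqxx mulr1; congr (_ == _)%:R.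
  by apply/ffunP => j; rewrite !ffunE permM.
rewrite /c -(inj_eq (@label_inj n)) {2}/label enum_rankK => /negbTE nd.
by rewrite !mxE nd mulr0.
Qed.

Lemma tens_permute n (p : 'S_n) (U : 'I_n -> 'M[C]_2) :
  tens U *m permute_qubits R p =
  permute_qubits R p *m tens (fun j => U (p^-1 j)%g).
Proof.
apply/matrixP => a b; rewrite !mxE.
(* A permutation matrix has one nonzero entry in each row and column, so both sums collapse: the
   left one to the index [c], the right one to [d]. *)
pose c := enum_rank [ffun j => label b (p j)].
pose d := enum_rank [ffun j => label a (p^-1 j)%g].
rewrite (bigD1 c) //= big1 ?addr0 => [|e]; last first.
  rewrite /c -(inj_eq (@label_inj n)) {2}/label enum_rankK => /negbTE nd.
  by rewrite !mxE nd mulr0.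
rewrite (bigD1 d) //= big1 ?addr0 => [|e]; last first.
  rewrite /d -(inj_eq (@label_inj n)) {2}/label enum_rankK => ne.
  rewrite !mxE; case: eqP => [ea|]; last by rewrite mul0r.
  by case/eqP: ne; apply/ffunP => j; rewrite ffunE ea ffunE permKV.
rewrite !mxE /c /d /label !enum_rankK eqxx mulr1.
have -> : (enum_val a == [ffun j => [ffun j0 => enum_val a (p^-1 j0)%g] (p j)]).
  by apply/eqP/ffunP => j; rewrite !ffunE permK.
rewrite mul1r (reindex_inj (@perm_inj _ p^-1%g)) /=.
by apply: eq_bigr => j _; rewrite !ffunE permKV.
Qed.

End TensorProducts.

(** * Pauli matrices and Pauli strings *)

Section Paulis.
Local Open Scope sesquilinear_scope.
Variable R : realType.
Local Notation C := R[i].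
Local Notation pauli_mx := (@pauli_mx R).

Lemma sum_ord2 {V : nmodType} (F : 'I_2 -> V) : \sum_(i < 2) F i = F 0 + F 1.
Proof.
rewrite !big_ord_recl big_ord0 addr0; congr (_ + F _); exact: val_inj.
Qed.

Lemma ord2P (P : 'I_2 -> Prop) : P 0 -> P 1 -> forall i, P i.
Proof.
move=> P0 P1 [[|[|i]] lt_i2] //; [move: P0 | move: P1];
  by congr P; apply: val_inj.
Qed.

Lemma matrix2P (A B : 'M[C]_2) :
  A 0 0 = B 0 0 -> A 0 1 = B 0 1 -> A 1 0 = B 1 0 -> A 1 1 = B 1 1 -> A = B.
Proof. by move=> *; apply/matrixP; apply: ord2P; apply: ord2P. Qed.

Lemma mulCi : 'i * 'i = -1 :> C.
Proof. by rewrite -expr2 sqrCi. Qed.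

Lemma pauli_mx_adj p : (pauli_mx p)^t* = pauli_mx p.
Proof.
by case: p; apply: matrix2P; rewrite !mxE /= ?(rmorphN, rmorph0, rmorph1) //=
  ?conjCi ?opprK ?(expr0, expr1) ?rmorphN ?rmorph1.
Qed.

Lemma pauli_mx_sq p : pauli_mx p *m pauli_mx p = 1%:M.
Proof.
by case: p; first (by rewrite mulmx1); apply: matrix2P;
  rewrite !mxE sum_ord2 !mxE /= ?(mulr0, mul0r, addr0, add0r, mulr1) //
    ?(expr0, expr1) ?(mulrN, mulNr, mulr1, mulCi, opprK).
Qed.

Lemma pauli_mx_unitary p : pauli_mx p \is unitarymx.
Proof. by apply/unitarymxP; rewrite pauli_mx_adj pauli_mx_sq. Qed.

Definition pauli_anti (p q : pauli_letter) : bool :=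
  match p, q with
  | PX, (PY | PZ) | PY, (PX | PZ) | PZ, (PX | PY) => true
  | _, _ => false
  end.

Lemma pauli_mx_swap p q :
  pauli_mx p *m pauli_mx q = (-1) ^+ pauli_anti p q *: (pauli_mx q *m pauli_mx p).
Proof.
case: p; first (by rewrite mulmx1 mul1mx /= expr0 scale1r);
case: q; first [by rewrite mulmx1 mul1mx /= expr0 scale1r
  | by rewrite /= expr0 scale1r
  | by apply: matrix2P; rewrite !mxE !sum_ord2 !mxE /=; ring].
Qed.

(** Distinct non-identity letters anticommute, so a letter commuting with [r] is [PI] or [r] itself,
    and these commute. This is why a stabilizer element touching a site leaves at most one
    nontrivial letter there. *)
Lemma pauli_anti_commute p q r : r <> PI -> ~~ pauli_anti p r -> ~~ pauli_anti q r ->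
  ~~ pauli_anti p q.
Proof. by case: r => // _; case: p => //; case: q. Qed.

Lemma pauli_mx_trace p : p <> PI -> \tr (pauli_mx p) = 0.
Proof.
by case: p => // _; rewrite /mxtrace sum_ord2 !mxE /= ?addr0 // expr0 expr1 subrr.
Qed.

Lemma pauli_mx_span (M : 'M[C]_2) : exists c : pauli_letter -> C,
  M = c PI *: pauli_mx PI + (c PX *: pauli_mx PX +
        (c PY *: pauli_mx PY + c PZ *: pauli_mx PZ)).
Proof.
(* The coefficient of a letter [p] is half the trace of [pauli_mx p *m M]. *)
exists (fun p => match p with
  | PI => (M 0 0 + M 1 1) / 2
  | PX => (M 0 1 + M 1 0) / 2
  | PY => 'i * (M 0 1 - M 1 0) / 2
  | PZ => (M 0 0 - M 1 1) / 2 end).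
have ii := mulCi.
apply: matrix2P; rewrite !mxE /=; [by field | idtac | idtac | by field].
- have -> : 'i * (M 0 1 - M 1 0) / 2 * - 'i =
           - ('i * 'i) * (M 0 1 - M 1 0) / 2 by ring.
  by rewrite ii; field.
- have -> : 'i * (M 0 1 - M 1 0) / 2 * 'i =
           ('i * 'i) * (M 0 1 - M 1 0) / 2 by ring.
  by rewrite ii; field.
Qed.

Lemma pauli_string_unitary n (r : 'I_n -> pauli_letter) :
  pauli_string R r \is unitarymx.
Proof. by apply: tens_unitary => j; apply: pauli_mx_unitary. Qed.

Lemma phases_norm (a : C) : a \in phases R -> a * a^* = 1.
Proof.
rewrite !inE => /or4P[]/eqP->; rewrite ?raddfN /= ?conjC1 ?conjCi.
- by rewrite mulr1.
- by rewrite mulrNN mulr1.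
- by rewrite mulrN mulCi opprK.
- by rewrite opprK mulNr mulCi opprK.
Qed.

(** Hence a group containing the scalar matrix of such a phase contains minus the identity, as that
    matrix itself or as its square. *)
Lemma phases_sq (a : C) : a \in phases R -> a != 1 -> a = -1 \/ a * a = -1.
Proof.
rewrite !inE => /or4P[]/eqP->; rewrite ?eqxx //= => _.
- by left.
- by right; rewrite mulCi.
- by right; rewrite mulrNN mulCi.
Qed.

Lemma pauli_group_unitary n (A : 'M[C]_(qdim n)) : pauli_group A -> A \is unitarymx.
Proof.
move=> [a [r [/phases_norm a1 ->]]]; apply/unitarymxP.
rewrite linearZ /= map_mxZ -scalemxAl -scalemxAr scalerA a1 scale1r.
exact/unitarymxP/pauli_string_unitary.
Qed.

Lemma on_site_pauli_swap n (s : 'I_n) p (r : 'I_n -> pauli_letter) :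
  on_site s (pauli_mx p) *m pauli_string R r =
  (-1) ^+ pauli_anti p (r s) *: (pauli_string R r *m on_site s (pauli_mx p)).
Proof.
(* The sign is written as a product over the sites, trivial except at [s], so that [tens_scale] can
   distribute it over the tensor factors. *)
have -> : (-1) ^+ pauli_anti p (r s) =
    \prod_(j < n) (if j == s then (-1) ^+ pauli_anti p (r s) else 1) :> C.
  by rewrite -big_mkcond /= big_pred1_eq.
rewrite !tens_mul -tens_scale; apply: eq_tens => j.
have [->|_] := eqVneq j s; first exact: pauli_mx_swap.
by rewrite mulmx1 mul1mx scale1r.
Qed.

Lemma pauli_string_trace n (r : 'I_n -> pauli_letter) j :
  r j <> PI -> \tr (pauli_string R r) = 0.
Proof.
by move=> /pauli_mx_trace rj; rewrite trace_tens (bigD1 j) //= rj mul0r.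
Qed.

Lemma pauli_string_PI n (r : 'I_n -> pauli_letter) :
  (forall j, r j = PI) -> pauli_string R r = 1%:M.
Proof. by move=> rI; rewrite -tens1; apply: eq_tens => j; rewrite rI. Qed.

End Paulis.

(** * Projectors onto stabilizer codes *)

Section AdjointMatrices.
Local Open Scope sesquilinear_scope.
Variable C : numClosedFieldType.

Lemma adj_mul m n p (A : 'M[C]_(m, n)) (B : 'M_(n, p)) : (A *m B)^t* = B^t* *m A^t*.
Proof. by rewrite trmx_mul map_mxM. Qed.

Lemma adj_scale m n (c : C) (A : 'M[C]_(m, n)) : (c *: A)^t* = c^* *: A^t*.
Proof. by apply/matrixP => a b; rewrite !mxE rmorphM. Qed.

Lemma adjB m n (A B : 'M[C]_(m, n)) : (A - B)^t* = A^t* - B^t*.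
Proof. by apply/matrixP => a b; rewrite !mxE rmorphB. Qed.

Lemma adj1 n : (1%:M : 'M[C]_n)^t* = 1%:M.
Proof. by rewrite trmx1 map_mx1. Qed.

Lemma adj_inj m n : injective (fun A : 'M[C]_(m, n) => A^t*).
Proof. by move=> A B eqAB; rewrite -[A]trmxCK eqAB trmxCK. Qed.

(** The trace is the sum of the squared moduli of the entries of [A]. *)
Lemma trace_adj_mul_eq0 m n (A : 'M[C]_(m, n)) : \tr (A^t* *m A) = 0 -> A = 0.
Proof.
rewrite /mxtrace => /eqP; rewrite psumr_eq0 => [/allP trA|b _]; last first.
  by rewrite mxE sumr_ge0 // => a _; rewrite !mxE mulrC mul_conjC_ge0.
apply/matrixP => a b; have := trA b (mem_index_enum _); rewrite /= mxE.
rewrite psumr_eq0 => [/allP/(_ a (mem_index_enum _))|c _].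
  by rewrite /= !mxE mulrC mul_conjC_eq0 => /eqP.
by rewrite !mxE mulrC mul_conjC_ge0.
Qed.

Lemma cols_in m d (P : 'M[C]_d) (A : 'M[C]_(d, m)) :
  (forall psi : 'cV[C]_m, P *m (A *m psi) = A *m psi) -> P *m A = A.
Proof.
move=> fixP; apply/matrixP => a b.
have := congr1 (fun v : 'cV[C]_d => v a 0) (fixP (delta_mx b 0)).
by rewrite mulmxA -!colE !mxE.
Qed.

Lemma unitary_adj_mul d (T : 'M[C]_d) : T \is unitarymx -> T^t* *m T = 1%:M.
Proof. by rewrite -trmxC_unitary => /unitarymxP; rewrite trmxCK. Qed.

(** In the basis given by [T], commuting with a diagonal matrix means that the entry at [x], [y]
    vanishes unless the diagonal values at [x] and [y] agree. Only the level sets of the diagonal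
    matter, so a matrix and its exponential can be compared without any matrix exponential. *)
Lemma commutant_diag d (T : 'M[C]_d) (f g : 'rV[C]_d) : T \is unitarymx ->
  (forall x y, f 0 x = f 0 y -> g 0 x = g 0 y) ->
  forall M, comm_mx M (T^t* *m diag_mx f *m T) -> comm_mx M (T^t* *m diag_mx g *m T).
Proof.
move=> uT fg M; have /unitarymxP TT := uT; have TT' := unitary_adj_mul uT.
move: (T^t*) TT TT' => {uT} Ts TT TT'; pose M' := T *m M *m Ts.
have conjM h : M' *m diag_mx h = diag_mx h *m M' <->
    comm_mx M (Ts *m diag_mx h *m T).
  have e1 : T *m (M *m (Ts *m diag_mx h *m T)) *m Ts = M' *m diag_mx h.
    by rewrite !mulmxA -(mulmxA _ T) TT mulmx1.
  have e2 : T *m ((Ts *m diag_mx h *m T) *m M) *m Ts = diag_mx h *m M'.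
    by rewrite !mulmxA TT mul1mx.
  split=> [|cM]; last by rewrite -e1 -e2 cM.
  rewrite -e1 -e2 /comm_mx; move: (M *m _) (_ *m M) => X Y.
  move/(congr1 (fun A : 'M[C]_d => Ts *m A *m T)).
  have back Z : Ts *m (T *m Z *m Ts) *m T = Z.
    by rewrite -(mulmxA T) (mulmxA Ts T) TT' mul1mx -mulmxA TT' mulmx1.
  by rewrite !back.
clearbody M'; move=> /conjM /matrixP cf; apply/conjM/matrixP => x y; have := cf x y.
rewrite !mul_mx_diag !mul_diag_mx !mxE mulrC.
have [->|nz] := eqVneq (M' x y) 0; first by rewrite !(mulr0, mul0r).
by move/(mulIf nz)/esym/fg => ->; rewrite mulrC.
Qed.

Lemma conjmx_exp d (T Ts A : 'M[C]_d) m : Ts *m T = 1%:M -> T *m Ts = 1%:M ->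
  (T *m A *m Ts) ^+ m = T *m A ^+ m *m Ts.
Proof.
move=> TT' TT; elim: m => [|m IHm]; first by rewrite !expr0 mulmx1.
by rewrite !exprS IHm -!mulmxE !mulmxA -(mulmxA _ Ts) TT' mulmx1.
Qed.

Lemma diag_mx_exp d (f : 'rV[C]_d) m : diag_mx f ^+ m = diag_mx (\row_x f 0 x ^+ m).
Proof.
elim: m => [|m IHm].
  by rewrite expr0 -[1]/(1%:M) -diag_const_mx; congr diag_mx; apply/rowP => x; rewrite !mxE.
rewrite exprS IHm -mulmxE mulmx_diag.
by congr diag_mx; apply/rowP => x; rewrite !mxE exprS.
Qed.

(** A unitary is normal, hence unitarily diagonalizable; its diagonal form is again unitary, which
    makes the eigenvalues unimodular. *)
Lemma unitary_spectral d (U : 'M[C]_d) : U \is unitarymx ->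
  exists (T : 'M[C]_d) (D : 'rV[C]_d), [/\ T \is unitarymx,
    U = T^t* *m diag_mx D *m T & forall x, D 0 x * (D 0 x)^* = 1].
Proof.
move=> uU; have /unitarymxP UU := uU.
have nU : U \is normalmx by apply/normalmxP; rewrite UU unitary_adj_mul.
exists (spectralmx U), (spectral_diag U).
have uT := spectral_unitarymx U; have /unitarymxP TT := uT.
have eU : U = (spectralmx U)^t* *m diag_mx (spectral_diag U) *m spectralmx U.
  by rewrite {1}(orthomx_spectralP nU) invmx_unitary.
split=> // x.
have : diag_mx (spectral_diag U) *m (diag_mx (spectral_diag U))^t* = 1%:M.
  have <- : spectralmx U *m U *m (spectralmx U)^t* = diag_mx (spectral_diag U).
    by rewrite {2}eU !mulmxA TT mul1mx -mulmxA TT mulmx1.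
  rewrite !adj_mul trmxCK !mulmxA -(mulmxA _ _ (spectralmx U)) unitary_adj_mul // mulmx1.
  by rewrite -(mulmxA _ U) UU mulmx1 TT.
move=> /matrixP/(_ x x); rewrite mul_diag_mx !mxE !eqxx !mulr1n.
by [].
Qed.

(** As [P] commutes with [H] and [H'], the compressions are [H *m P] and [H' *m P]. Then [H' *m P]
    commutes with [H], hence with [V]; so [V *m P] commutes with [H' *m P], hence with [H'], hence
    with [V']. *)
Lemma comm_compress d (P V V' H H' : 'M[C]_d) : P *m P = P ->
  (forall M, comm_mx M V <-> comm_mx M H) ->
  (forall M, comm_mx M V' <-> comm_mx M H') ->
  comm_mx P V -> comm_mx P V' -> comm_mx (P *m H *m P) (P *m H' *m P) ->
  comm_mx (V *m P) (V' *m P).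
Proof.
move=> PP VH VH' PV PV'; have PH := (VH P).1 PV; have PH' := (VH' P).1 PV'.
rewrite PH PH' -!mulmxA PP => HH'.
have lift A B : comm_mx P A -> comm_mx P B -> comm_mx (A *m P) (B *m P) ->
    comm_mx (B *m P) A.
  move=> PA PB AB; rewrite /comm_mx.
  have -> : A *m (B *m P) = (A *m P) *m (B *m P).
    by rewrite -mulmxA (mulmxA P) PB -(mulmxA B) PP.
  by rewrite AB -!mulmxA (mulmxA P A) PA -(mulmxA A) PP -PA.
have PXP X : comm_mx P X -> comm_mx P (X *m P).
  by move=> PX; apply: comm_mxM.
have VH'P : comm_mx (V *m P) (H' *m P).
  apply: comm_mx_sym; apply: comm_mxM; first exact/VH/lift.
  exact/comm_mx_sym/PXP.
apply: comm_mxM; last exact/comm_mx_sym/PXP.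
by apply/VH'/lift => //; apply: comm_mx_sym.
Qed.

(** The group commutator, with adjoints for inverses since the arguments are meant to be unitary. *)
Definition unitary_commutator d (A B : 'M[C]_d) := A *m B *m A^t* *m B^t*.

Lemma unitary_commutator_conj d (T A B : 'M[C]_d) : T^t* *m T = 1%:M ->
  T *m unitary_commutator A B *m T^t* =
  unitary_commutator (T *m A *m T^t*) (T *m B *m T^t*).
Proof.
move=> TT; rewrite /unitary_commutator !adj_mul !trmxCK.
move: (T^t*) TT (A^t*) (B^t*) => Ts TT As Bs.
have cancel X Y : X *m Ts *m (T *m Y) = X *m Y.
  by rewrite -mulmxA (mulmxA Ts) TT mul1mx.
rewrite -(mulmxA T B) cancel (mulmxA (T *m A)) cancel (mulmxA _ As) cancel.
by rewrite !mulmxA.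
Qed.

Lemma unitary_commutator_unitary d (A B : 'M[C]_d) :
  A \is unitarymx -> B \is unitarymx -> unitary_commutator A B \is unitarymx.
Proof.
move=> uA uB; have uA' : A^t* \is unitarymx by rewrite trmxC_unitary.
have uB' : B^t* \is unitarymx by rewrite trmxC_unitary.
exact: mul_unitarymx (mul_unitarymx (mul_unitarymx uA uB) uA') uB'.
Qed.

Lemma det_unitary_commutator d (A B : 'M[C]_d) :
  A \is unitarymx -> B \is unitarymx -> \det (unitary_commutator A B) = 1.
Proof.
move=> /unitarymxP AA /unitarymxP BB; rewrite /unitary_commutator !det_mulmx.
have detAA : \det A * \det (A^t*) = 1 by rewrite -det_mulmx AA det1.
have detBB : \det B * \det (B^t*) = 1 by rewrite -det_mulmx BB det1.
move: (\det A) (\det B) (\det (A^t*)) (\det (B^t*)) detAA detBB => a b a' b' aa bb.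
have -> : a * b * a' * b' = (a * a') * (b * b') by ring.
by rewrite aa bb mulr1.
Qed.

End AdjointMatrices.

Section Projectors.
Local Open Scope sesquilinear_scope.
Variable R : realType.
Local Notation C := R[i].

Lemma orthogonal_projector_fix d (Q : set 'cV[C]_d) (P : 'M[C]_d) psi :
  is_orthogonal_projector Q P -> Q psi -> P *m psi = psi.
Proof. by case=> PP _ <- [phi _ <-]; rewrite mulmxA PP. Qed.

(** Each projector fixes the range of the other: [P' *m P = P] and [P *m P' = P']. The adjoint of
    the first equation is [P *m P' = P]. *)
Lemma orthogonal_projector_uniq d (Q : set 'cV[C]_d) (P P' : 'M[C]_d) :
  is_orthogonal_projector Q P -> is_orthogonal_projector Q P' -> P = P'.
Proof.
move=> hP hP'.
have le (P1 P2 : 'M[C]_d) : is_orthogonal_projector Q P1 ->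
    is_orthogonal_projector Q P2 -> P1 *m P2 = P2.
  move=> h1 h2; apply: cols_in => psi; apply: (orthogonal_projector_fix h1).
  by case: h2 => _ _ <-; exists psi.
have [_ aP _] := hP; have [_ aP' _] := hP'.
have := congr1 (fun A : 'M[C]_d => A^t*) (le _ _ hP' hP).
by rewrite adj_mul aP aP' (le _ _ hP hP') => ->.
Qed.

Lemma orthogonal_projectorE d (Q : set 'cV[C]_d) (P : 'M[C]_d) :
  is_orthogonal_projector Q P -> orthogonal_projector Q = P.
Proof.
move=> hP; apply: (orthogonal_projector_uniq (Q := Q)) => //.
exact: (xgetPex 0 (ex_intro _ P hP)).
Qed.

End Projectors.

(** * The code projector as an average over the stabilizer *)

Section StabilizerProjector.
Local Open Scope sesquilinear_scope.
Variables (R : realType) (n k : nat) (S : set 'M[R[i]]_(qdim n)).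
Hypotheses (hS : stabilizer S) (le_kn : (k <= n)%N).
Hypothesis hcard : (S #= `I_(2 ^ (n - k)))%card.
Local Notation C := R[i].

Lemma stabilizer_unitary A : S A -> A \is unitarymx.
Proof. by case: hS => sub _ _ _ /sub; apply: pauli_group_unitary. Qed.

Lemma stabilizer_adj A : S A -> S (A^t*).
Proof.
move=> SA; rewrite -invmx_unitary ?stabilizer_unitary //.
by case: hS => _ [_ _ inv] _ _; apply: inv.
Qed.

Lemma stabilizer_seq : exists l : seq 'M[C]_(qdim n),
  [/\ uniq l, size l = (2 ^ (n - k))%N & forall A, S A <-> A \in l].
Proof.
have finS : finite_set S by apply/finite_setP; exists (2 ^ (n - k))%N.
exists (finmap.enum_fset (fset_set S)); split; first exact: finmap.fset_uniq.
  exact: card_fset_set.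
by move=> A; rewrite in_fset_set // in_setE.
Qed.

(** A non-identity letter makes the trace vanish. Without one, [A] is a phase times the identity,
    and a phase other than 1 would put minus the identity into [S]. *)
Lemma stabilizer_trace A : S A -> A != 1%:M -> \tr A = 0.
Proof.
case: hS => sub [S1 SM _] _ SN1 SA; have [a [r [aph eA]]] := sub _ SA.
have [[j rj] _|noj] := pselect (exists j, r j <> PI).
  by rewrite eA linearZ /= (pauli_string_trace _ rj) mulr0.
have rI j : r j = PI.
  by case: (pselect (r j = PI)) => // rj; case: noj; exists j.
rewrite {}eA pauli_string_PI // scalemx1 in SA *.
have [->|a1 _] := eqVneq a 1; first by rewrite eqxx.
case: (phases_sq aph a1) => [aE|aa]; case: SN1.
  by rewrite -scaleN1r scalemx1 -aE.
by rewrite -scaleN1r scalemx1 -aa scalar_mxM; apply: SM.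
Qed.

(** The projector is the average of the elements of [S]. Multiplication by an element and passage to
    adjoints both permute [S], and only the identity contributes to the trace, which is therefore
    2^n / 2^(n-k). *)
Lemma stabilizer_projector : exists P : 'M[C]_(qdim n),
  [/\ is_orthogonal_projector (codespace S) P,
      forall A, S A -> A *m P = P,
      forall B, (forall A, S A -> A *m B = B *m A) -> P *m B = B *m P
    & \tr P = (2 ^ k)%:R].
Proof.
have [l [ul sl lP]] := stabilizer_seq.
have [sub [S1 SM SV] _ SN1] := hS.
pose N := (2 ^ (n - k))%N.
have N0 : N%:R != 0 :> C by rewrite pnatr_eq0 expn_eq0.
pose P : 'M[C]_(qdim n) := N%:R^-1 *: \sum_(A <- l) A.
have AP A : S A -> A *m P = P.
  move=> SA; rewrite /P -scalemxAr; congr (_ *: _).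
  rewrite mulmx_sumr -(big_map (mulmx A) predT id); apply: perm_big.
  have Au : A \in unitmx by rewrite unitarymx_unit ?stabilizer_unitary.
  have injA : injective (fun B : 'M[C]_(qdim n) => A *m B) := can_inj (mulKmx Au).
  apply: uniq_perm => //; first by rewrite map_inj_uniq.
  move=> B; apply/mapP/idP => [[B' /lP SB' ->]|/lP SB]; first exact/lP/SM.
  exists (invmx A *m B); last by rewrite mulKVmx.
  by apply/lP/SM => //; apply: SV.
have Pfix psi : codespace S psi -> P *m psi = psi.
  move=> Qpsi; rewrite /P -scalemxAl mulmx_suml (eq_big_seq (fun=> psi)).
    rewrite big_const_seq count_predT sl iter_addr_0 -[psi *+ _]scaler_nat scalerA.
    by rewrite mulVf ?scale1r.
  by move=> A /lP; apply: Qpsi.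
exists P; split => //.
- split.
  + apply: cols_in => psi; apply: Pfix => A SA; by rewrite mulmxA AP.
  + rewrite /P adj_scale fmorphV rmorph_nat; congr (_ *: _).
    rewrite linear_sum /= map_mx_sum -(big_map (fun A : 'M[C]_(qdim n) => A^t*) predT id).
    apply: perm_big; apply: uniq_perm => //.
      by rewrite map_inj_uniq //; apply: adj_inj.
    move=> B; apply/mapP/idP => [[B' /lP SB' ->]|/lP SB].
      exact/lP/stabilizer_adj.
    by exists (B^t*); rewrite ?trmxCK //; apply/lP/stabilizer_adj.
  + apply/seteqP; split => [_ [phi _ <-] A SA|psi Qpsi].
      by rewrite mulmxA AP.
    by exists psi => //; apply: Pfix.
- move=> B comB; rewrite /P -scalemxAl -scalemxAr mulmx_suml mulmx_sumr.
  by congr (_ *: _); apply: eq_big_seq => A /lP; apply: comB.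
- rewrite /P linearZ /= linear_sum /= (bigD1_seq 1%:M) //=; last exact/lP.
  rewrite big_seq_cond big1 ?addr0 => [|A /andP[/lP]]; last exact: stabilizer_trace.
  rewrite mxtrace1 qdimE -(subnKC le_kn) expnD natrM mulrCA.
  by rewrite mulVf ?mulr1.
Qed.

Lemma code_projectorP : is_orthogonal_projector (codespace S) (code_projector S).
Proof.
have [P [hP _ _ _]] := stabilizer_projector.
by rewrite /code_projector (orthogonal_projectorE hP).
Qed.

Lemma code_projector_stab A : S A -> A *m code_projector S = code_projector S.
Proof.
have [P [hP hA _ _]] := stabilizer_projector.
by rewrite /code_projector (orthogonal_projectorE hP); apply: hA.
Qed.

Lemma code_projector_comm B : (forall A, S A -> A *m B = B *m A) ->
  code_projector S *m B = B *m code_projector S.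
Proof.
have [P [hP _ hC _]] := stabilizer_projector.
by rewrite /code_projector (orthogonal_projectorE hP); apply: hC.
Qed.

Lemma code_projector_trace : \tr (code_projector S) = (2 ^ k)%:R.
Proof.
have [P [hP _ _ trP]] := stabilizer_projector.
by rewrite /code_projector (orthogonal_projectorE hP).
Qed.

End StabilizerProjector.

(** * Existence of a logical encoding *)

Section LogicalEncoding.
Local Open Scope sesquilinear_scope.
Variables (R : realType) (n k : nat) (S : set 'M[R[i]]_(qdim n)).
Hypotheses (hS : stabilizer S) (le_kn : (k <= n)%N).
Hypothesis hcard : (S #= `I_(2 ^ (n - k)))%card.
Variables Xb Zb : 'I_k -> 'M[R[i]]_(qdim n).
Hypothesis hL : logical_paulis S Xb Zb.
Local Notation C := R[i].
Local Notation Q := (codespace S).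

Lemma centralizer_codespace A psi : pauli_centralizer S A -> Q psi -> Q (A *m psi).
Proof. by move=> [_ cA] Qpsi B SB; rewrite mulmxA -cA // -mulmxA Qpsi. Qed.

Lemma logical_X_sq i : Xb i *m Xb i = 1%:M.
Proof.
have [/(_ i) [[/pauli_group_unitary/unitarymxP XX _] _ hX _] _ _ _ _] := hL.
by rewrite -{2}hX.
Qed.

Lemma logical_Z_sq i : Zb i *m Zb i = 1%:M.
Proof.
have [/(_ i) [_ [/pauli_group_unitary/unitarymxP ZZ _] _ hZ] _ _ _ _] := hL.
by rewrite -{2}hZ.
Qed.

Lemma logical_ZX i j :
  Zb i *m Xb j = (-1) ^+ (j == i) *: (Xb j *m Zb i).
Proof.
have [_ _ _ XZ _] := hL.
by rewrite XZ scalerA -expr2 sqrr_sign scale1r.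
Qed.

Lemma codespace_neq0 : exists2 psi : 'cV[C]_(qdim n), psi != 0 & Q psi.
Proof.
have trP := code_projector_trace hS le_kn hcard.
have [P0|] := eqVneq (code_projector S) 0.
  by move: trP; rewrite P0 linear0 => /esym/eqP; rewrite pnatr_eq0 expn_eq0.
case/matrix0Pn => a [b Pab]; exists (col b (code_projector S)).
  apply: contraNneq Pab => /(congr1 (fun v : 'cV[C]_(qdim n) => v a 0)).
  by rewrite !mxE => ->.
move=> A SA; rewrite !colE mulmxA.
by rewrite (code_projector_stab hS le_kn hcard).
Qed.

(** The logical state with all bits 0. A nonzero code vector is adjusted so as to be fixed by one
    more [Zb j] at a time, and normalized at the end. *)
Lemma logical_zero_state : exists2 psi : 'cV[C]_(qdim n),
  Q psi /\ psi^t* *m psi = 1%:M & forall i, Zb i *m psi = psi.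
Proof.
have [hC _ ZZ _ _] := hL.
suff /(_ k (leqnn k)) [psi [psi0 Qpsi Zpsi]] : forall m, (m <= k)%N ->
    exists psi : 'cV[C]_(qdim n), [/\ psi != 0, Q psi &
      forall i : 'I_k, (i < m)%N -> Zb i *m psi = psi].
  pose c := (psi^t* *m psi) 0 0.
  have c_gt0 : 0 < c.
    rewrite lt_def; apply/andP; split; last first.
      by rewrite /c mxE sumr_ge0 // => a _; rewrite !mxE mulrC mul_conjC_ge0.
    apply: contra_neq psi0 => c0; apply: trace_adj_mul_eq0.
    by rewrite /mxtrace big_ord_recl big_ord0 addr0.
  exists ((sqrtC c)^-1 *: psi); last first.
    by move=> i; rewrite -scalemxAr Zpsi.
  split; first by move=> A SA; rewrite -scalemxAr Qpsi.
  rewrite adj_scale -scalemxAl -scalemxAr scalerA.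
  apply/matrixP => a b; rewrite !ord1 mxE -/c mxE /=.
  have -> : ((sqrtC c)^-1)^* = (sqrtC c)^-1.
    by rewrite geC0_conj // invr_ge0 sqrtC_ge0 ltW.
  rewrite -invfM -expr2 sqrtCK.
  by rewrite mulVf // lt0r_neq0.
elim=> [|m IHm] lt_mk.
  by have [psi psi0 Qpsi] := codespace_neq0; exists psi; split.
have [psi [psi0 Qpsi Zpsi]] := IHm (ltnW lt_mk).
pose j := Ordinal lt_mk; have [cX cZ _ _] := hC j.
have lt_neq (i : 'I_k) : (i < m.+1)%N -> i != j -> (i < m)%N.
  by rewrite ltnS leq_eqVlt -val_eqE => /orP[->|].
(* If the projection of [psi] to the +1 eigenspace of [Zb j] vanishes, then [psi] is a -1
   eigenvector, and [Xb j] moves it to the +1 eigenspace without disturbing the other [Zb i]. *)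
have [ZN|Zp] := eqVneq (psi + Zb j *m psi) 0.
  have Zjpsi : Zb j *m psi = - psi by apply/eqP; rewrite -addr_eq0 addrC ZN.
  exists (Xb j *m psi); split.
  - apply: contra_neq psi0 => X0.
    by rewrite -[psi]mul1mx -(logical_X_sq j) -mulmxA X0 mulmx0.
  - exact: centralizer_codespace.
  - move=> i lt_i; rewrite mulmxA logical_ZX -scalemxAl -mulmxA.
    have [->|ne] := eqVneq i j.
      by rewrite Zjpsi mulmxN scalerN expr1 scaleN1r opprK.
    by rewrite expr0 scale1r Zpsi // lt_neq.
exists (psi + Zb j *m psi); split=> //.
- move=> A SA; rewrite mulmxDr (centralizer_codespace cZ Qpsi) //.
  by rewrite Qpsi.
- move=> i lt_i; rewrite mulmxDr.
  have [->|ne] := eqVneq i j.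
    by rewrite mulmxA logical_Z_sq mul1mx addrC.
  by rewrite mulmxA ZZ -mulmxA Zpsi // lt_neq.
Qed.

Definition flip_bit (x : 'I_2) : 'I_2 := if x == 0 then 1 else 0.

Definition toggle (i : 'I_k) (f : {ffun 'I_k -> 'I_2}) : {ffun 'I_k -> 'I_2} :=
  [ffun j => if j == i then flip_bit (f j) else f j].

(** With [r] enumerating all logical qubits, this operator takes the logical zero state to the basis
    state labelled [f]. A general [r] allows induction. *)
Definition logical_X_prod (r : seq 'I_k) (f : {ffun 'I_k -> 'I_2}) : 'M[C]_(qdim n) :=
  \big[mulmx/1%:M]_(j <- r) (if f j == 0 then 1%:M else Xb j).

Lemma logical_X_prod_cons j r f :
  logical_X_prod (j :: r) f = (if f j == 0 then 1%:M else Xb j) *m logical_X_prod r f.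
Proof. by rewrite /logical_X_prod big_cons. Qed.

Lemma logical_X_prod_toggle r i f : uniq r -> i \in r ->
  Xb i *m logical_X_prod r f = logical_X_prod r (toggle i f).
Proof.
have [_ XX _ _ _] := hL.
elim: r => // h r IHr /= /andP[hr ur]; rewrite inE !logical_X_prod_cons.
case: (eqVneq i h) hr => [<-{h}|ne] hr /=; last first.
  move=> ir; rewrite -[in RHS]IHr // !mulmxA ffunE [h == i]eq_sym (negbTE ne); congr (_ *m _).
  by case: eqP => _; rewrite ?mulmx1 ?mul1mx.
move=> _; rewrite ffunE eqxx /flip_bit mulmxA; congr (_ *m _).
  by case: eqP => [//|_] /=; rewrite ?mulmx1 ?logical_X_sq.
apply: eq_big_seq => j jr; rewrite ffunE.
by have [ji|//] := eqVneq j i; rewrite -ji jr in hr.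
Qed.

(** [Zb i] commutes with every factor except [Xb i], where it changes sign; as [r] is
    duplicate-free, this happens at most once. *)
Lemma logical_Z_prod r i f : uniq r ->
  Zb i *m logical_X_prod r f =
  (-1) ^+ ((i \in r) && (f i != 0)) *: (logical_X_prod r f *m Zb i).
Proof.
elim: r => [|h r IHr] /=; first by rewrite /logical_X_prod big_nil mulmx1 mul1mx scale1r.
move=> /andP[hr ur]; rewrite inE !logical_X_prod_cons.
have -> : Zb i *m ((if f h == 0 then 1%:M else Xb h) *m logical_X_prod r f) =
    (-1) ^+ ((h == i) && (f h != 0)) *: ((if f h == 0 then 1%:M else Xb h) *m
      (Zb i *m logical_X_prod r f)).
  rewrite !mulmxA; case: eqP => _ /=.
    by rewrite andbF mulmx1 mul1mx scale1r.
  by rewrite andbT logical_ZX -!scalemxAl.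
rewrite IHr // -scalemxAr scalerA mulmxA; congr (_ *: _).
rewrite eq_sym; case: eqP => [->|_] /=; last by rewrite expr0 mul1r.
by rewrite (negbTE hr) expr0 mulr1.
Qed.

Lemma logical_X_prod_unitary r f :
  (logical_X_prod r f)^t* *m logical_X_prod r f = 1%:M.
Proof.
have [/(_ _) hC _ _ _ _] := hL.
elim: r => [|h r IHr]; first by rewrite /logical_X_prod big_nil adj1 mulmx1.
rewrite logical_X_prod_cons.
rewrite adj_mul -mulmxA (mulmxA (_ ^t*) _ (logical_X_prod _ _)).
suff -> : (if f h == 0 then 1%:M else Xb h)^t* *m (if f h == 0 then 1%:M else Xb h) = 1%:M.
  by rewrite mul1mx.
case: eqP => _; first by rewrite adj1 mulmx1.
by have [_ _ -> _] := hC h; rewrite logical_X_sq.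
Qed.

Lemma logical_X_prod_codespace r f psi : Q psi -> Q (logical_X_prod r f *m psi).
Proof.
have [hC _ _ _ _] := hL; move=> Qpsi.
elim: r => [|h r IHr]; first by rewrite /logical_X_prod big_nil mul1mx.
rewrite logical_X_prod_cons -mulmxA.
case: eqP => _; first by rewrite mul1mx.
by apply: centralizer_codespace => //; have [] := hC h.
Qed.

Lemma on_site_PX i c b :
  on_site i (pauli_mx R PX) c b = (label c == toggle i (label b))%:R.
Proof.
rewrite (@tens_delta _ _ _ (fun j x y => if j == i then x != y else x == y)).
  congr (_%:R); congr nat_of_bool; apply/forallP/eqP => [h|-> j].
    apply/ffunP => j; rewrite ffunE; have := h j; case: (j == i) => [|/eqP //].
    by move: (label c j) (label b j); apply: ord2P; apply: ord2P.
  rewrite ffunE; case: (j == i) => //.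
  by move: (label b j); apply: ord2P.
by move=> j x y; case: (j == i); rewrite mxE.
Qed.

Lemma on_site_PZ i (c b : 'I_(qdim k)) :
  on_site i (pauli_mx R PZ) c b =
  (c == b)%:R * (-1) ^+ (label b i != 0).
Proof.
rewrite mxE; have [->|ne] := eqVneq c b; last first.
  have [j nej] : exists j, label c j != label b j.
    apply/existsP; rewrite -negb_forall; apply: contra_neqN ne => /forallP h.
    by apply: label_inj; apply/ffunP => j; apply/eqP.
  rewrite (bigD1 j) //= mul0r; case: (j == i); rewrite mxE (negbTE nej) ?mul0r //.
rewrite mul1r (bigD1 i) //= eqxx mxE eqxx big1 ?mulr1 => [|j /negbTE ->].
  by move: (label b i); apply: ord2P.
by rewrite mxE eqxx.
Qed.

(** The columns of [E] are the logical basis states [v b], obtained from the zero state by flipping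
    the bits set in [b]. *)
Lemma logical_encoding_exists : exists E : 'M[C]_(qdim n, qdim k),
  logical_encoding S Xb Zb E /\ E *m E^t* = code_projector S.
Proof.
have [hC _ _ _ _] := hL.
have [psi [Qpsi psi1] Zpsi] := logical_zero_state.
pose r := index_enum 'I_k; have ur : uniq r := index_enum_uniq _.
have rP i : i \in r := mem_index_enum i.
pose v b := logical_X_prod r (label b) *m psi.
pose E : 'M[C]_(qdim n, qdim k) := \matrix_(a, b) v b a 0.
have AE m (A : 'M[C]_(m, qdim n)) a b : (A *m E) a b = (A *m v b) a 0.
  by rewrite !mxE; apply: eq_bigr => c _; rewrite mxE.
have Zv i b : Zb i *m v b = (-1) ^+ (label b i != 0) *: v b.
  by rewrite /v mulmxA logical_Z_prod // rP /= -scalemxAl -mulmxA Zpsi.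
have E1 : E^t* *m E = 1%:M.
  apply/matrixP => b c; rewrite AE mxE.
  have -> : \sum_j (E^t*) b j * v c j 0 = ((v b)^t* *m v c) 0 0.
    by rewrite mxE; apply: eq_bigr => j _; rewrite !mxE.
  rewrite [RHS]mxE; have [->|ne] := eqVneq b c.
    rewrite /v adj_mul mulmxA -(mulmxA _ _ (logical_X_prod r _)).
    by rewrite logical_X_prod_unitary mulmx1 psi1 mxE.
  have [i nei] : exists i, label b i != label c i.
    apply/existsP; rewrite -negb_forall; apply: contra_neqN ne => /forallP h.
    by apply: label_inj; apply/ffunP => j; apply/eqP.
  have [_ _ _ hZ] := hC i.
  have sE (x : C) (M : 'M[C]_1) : (x *: M) 0 0 = x * M 0 0 by rewrite mxE.
  (* [Zb i] is Hermitian with opposite eigenvalues on [v b] and [v c], so their inner product equals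
     its own negative. *)
  have : (v b)^t* *m (Zb i *m v c) = (Zb i *m v b)^t* *m v c.
    by rewrite -{1}hZ mulmxA -adj_mul.
  rewrite !Zv adj_scale -scalemxAl -scalemxAr rmorph_sign.
  move/(congr1 (fun M : 'M[C]_1 => M 0 0)); rewrite !sE.
  have {nei}: (label b i != 0) != (label c i != 0).
    by move: nei; move: (label b i) (label c i); apply: ord2P; apply: ord2P.
  have nx (x : C) : x = - x -> x = 0.
    by move/eqP; rewrite -addr_eq0 -mulr2n mulrn_eq0 /= => /eqP.
  case: (label b i != 0) (label c i != 0) => [] [] //= _;
    rewrite expr0 expr1 mul1r mulN1r => h; apply: nx; first [exact: h | exact: esym h].
have Efix A : S A -> A *m E = E.
  move=> SA; apply/matrixP => a b; rewrite AE [RHS]mxE.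
  by rewrite /v (logical_X_prod_codespace _ _ Qpsi SA).
have hP := code_projectorP hS le_kn hcard.
have [PP aP rangeP] := hP; set P := code_projector S in PP aP rangeP hP *.
have PE : P *m E = E.
  apply: cols_in => phi; apply: (orthogonal_projector_fix hP) => A SA.
  by rewrite mulmxA Efix.
(* Both sides are projectors, the left one below [P], and both have trace 2^k; hence their
   difference is a projector of trace 0. *)
have EP : E *m E^t* = P.
  apply/eqP; rewrite eq_sym -subr_eq0; apply/eqP/trace_adj_mul_eq0.
  have PF : P *m (E *m E^t*) = E *m E^t* by rewrite mulmxA PE.
  have FP : (E *m E^t*) *m P = E *m E^t*.
    by rewrite -mulmxA -{1}aP -adj_mul PE.
  have FF : (E *m E^t*) *m (E *m E^t*) = E *m E^t*.
    by rewrite mulmxA -(mulmxA E) E1 mulmx1.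
  rewrite adjB aP adj_mul trmxCK mulmxBl !mulmxBr.
  rewrite PP PF FP FF subrr subr0 linearB /= [\tr (E *m _)]mxtrace_mulC E1.
  by rewrite (code_projector_trace hS le_kn hcard) mxtrace1 qdimE subrr.
exists E; split => //; split => //.
- rewrite -rangeP -EP; apply/seteqP; split => [_ [phi _ <-]|_ [phi _ <-]].
    by exists (E *m phi) => //; rewrite -mulmxA (mulmxA _ E) E1 mul1mx.
  by exists (E^t* *m phi) => //; rewrite mulmxA.
- have labK f : label (enum_rank f) = f := enum_rankK f.
  move=> i; apply/matrixP => a b; rewrite AE /v mulmxA logical_X_prod_toggle //.
  rewrite [RHS]mxE (bigD1 (enum_rank (toggle i (label b)))) //= big1 => [|c].
    by rewrite addr0 on_site_PX labK eqxx mulr1 [RHS]mxE /v labK.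
  rewrite -(inj_eq (@label_inj k)) labK => ne.
  by rewrite on_site_PX (negbTE ne) mulr0.
- move=> i; apply/matrixP => a b; rewrite AE Zv [RHS]mxE (bigD1 b) //= big1.
    by rewrite on_site_PZ eqxx mul1r addr0 [LHS]mxE [E _ _]mxE mulrC.
  by move=> c ne; rewrite on_site_PZ (negbTE ne) mul0r mulr0.
Qed.

End LogicalEncoding.

(** * Compressions of single-site operators *)

Section Compression.
Local Open Scope sesquilinear_scope.
Variables (R : realType) (n k : nat) (S : set 'M[R[i]]_(qdim n)).
Hypotheses (hS : stabilizer S) (le_kn : (k <= n)%N).
Hypothesis hcard : (S #= `I_(2 ^ (n - k)))%card.
Hypothesis hfree : free_of_trivially_encoded_qubits S.
Local Notation C := R[i].
Local Notation P := (code_projector S).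
Local Notation compress A := (P *m A *m P).

Lemma comm_mxZ d (A B : 'M[C]_d) c : comm_mx A B -> comm_mx A (c *: B).
Proof. by rewrite /comm_mx -scalemxAl -scalemxAr => ->. Qed.

Lemma stab_code_projector A : S A -> P *m A = P.
Proof.
move=> SA; have [_ _ cS _] := hS.
rewrite (code_projector_comm hS le_kn hcard) ?(code_projector_stab hS le_kn hcard) //.
by move=> B SB; apply: cS.
Qed.

Lemma code_projector_idem : P *m P = P.
Proof. by have [] := code_projectorP hS le_kn hcard. Qed.

(** If some [B] in [S] anticommutes with [A], inserting [B] next to [P] and moving it across [A]
    gives [P A P = - P A P]. Otherwise [A] commutes with all of [S], hence with the average [P]. *)
Lemma compress_pauli (j : 'I_n) p (A := on_site j (pauli_mx R p)) :
  compress A = 0 \/ comm_mx P A /\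
    forall (r : 'I_n -> pauli_letter) a,
      a != 0 -> S (a *: pauli_string R r) -> ~~ pauli_anti p (r j).
Proof.
have [sub _ _ _] := hS.
have swap a r : A *m (a *: pauli_string R r) =
    (-1) ^+ pauli_anti p (r j) *: ((a *: pauli_string R r) *m A).
  by rewrite -scalemxAr on_site_pauli_swap -scalemxAl !scalerA mulrC.
have [[B [SB nB]]|all_comm] := pselect (exists B, S B /\ A *m B <> B *m A); last first.
  right; split.
    apply: (code_projector_comm hS le_kn hcard) => B SB.
    by apply/esym; case: (pselect (A *m B = B *m A)) => // ne; case: all_comm; exists B.
  move=> r a a0 SB; apply/negP => anti; have := swap a r; rewrite anti expr1 scaleN1r.
  set B := a *: _ in SB *; have -> : A *m B = B *m A.
    by case: (pselect (A *m B = B *m A)) => // ne; case: all_comm; exists B.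
  (* Commuting and anticommuting at once forces [B *m A] to vanish; since [A] squares to the
     identity, [B] would be 0, but it is a nonzero multiple of a unitary. *)
  move=> BA; have : B *m A *m A = 0.
    apply/eqP; have /eqP := congr1 (fun M => M *m A) BA.
    rewrite mulNmx -addr_eq0 -mulr2n -scaler_nat scaler_eq0 pnatr_eq0 //.
  rewrite -mulmxA on_site_mul pauli_mx_sq on_site1 mulmx1 => B0.
  have /unitarymxP := pauli_string_unitary R r.
  move/eqP: B0; rewrite scaler_eq0 (negbTE a0) /= => /eqP ->.
  rewrite mul0mx => /matrixP/(_ (enum_rank [ffun=> 0]) (enum_rank [ffun=> 0])).
  by rewrite !mxE eqxx => /eqP; rewrite eq_sym oner_eq0.
left; have [a [r [_ eB]]] := sub _ SB.
have AB : A *m B = - (B *m A).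
  have := swap a r; rewrite -eB; case: (pauli_anti _ _) => [|/=].
    by rewrite expr1 scaleN1r.
  by rewrite expr0 scale1r.
have cN : compress A = - compress A.
  rewrite -[X in _ *m X = _](code_projector_stab hS le_kn hcard SB) mulmxA -(mulmxA P) AB.
  by rewrite mulmxN mulNmx mulmxA (stab_code_projector SB).
by move/eqP: cN; rewrite -addr_eq0 -mulr2n -scaler_nat scaler_eq0 pnatr_eq0 => /eqP.
Qed.

(** Only letters commuting with [P] survive compression. On distinct sites they commute anyway; on a
    common site both commute with the non-identity letter of a stabilizer element there, hence with
    each other. *)
Lemma compress_pauli_comm (i j : 'I_n) p q :
  comm_mx (compress (on_site i (pauli_mx R p))) (compress (on_site j (pauli_mx R q))).
Proof.
have [->|[cA hA]] := compress_pauli i p; first exact: comm0mx.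
have [->|[cB hB]] := compress_pauli j q; first exact: comm_mx0.
set A := on_site i _ in cA *; set B := on_site j _ in cB *.
suff AB : comm_mx A B.
  have AP : comm_mx A P by apply: comm_mx_sym.
  have BP : comm_mx B P by apply: comm_mx_sym.
  have cBX X : comm_mx X P -> comm_mx X B -> comm_mx (compress B) X.
    by move=> XP XB; apply/comm_mx_sym/comm_mxM => //; apply: comm_mxM.
  apply/comm_mx_sym/comm_mxM; first apply: comm_mxM; exact: cBX.
have [eij|ne] := eqVneq i j; last exact: on_site_comm.
rewrite -{j}eij in B cB hB *.
have [a [r [aph SA rj]]] := hfree i.
have a0 : a != 0.
  by apply: contra_eq_neq (phases_norm aph) => ->; rewrite mul0r eq_sym oner_neq0.
have /negbTE anti := pauli_anti_commute rj (hA _ _ a0 SA) (hB _ _ a0 SA).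
by rewrite /comm_mx !on_site_mul pauli_mx_swap anti expr0 scale1r.
Qed.

(** Compression is linear and the Pauli matrices span, so the case of letters extends to each
    argument in turn. *)
Lemma compress_on_site_comm (i j : 'I_n) (A B : 'M[C]_2) :
  comm_mx (compress (on_site i A)) (compress (on_site j B)).
Proof.
have span (M : 'M[C]_(qdim n)) s D :
    (forall p, comm_mx M (compress (on_site s (pauli_mx R p)))) ->
    comm_mx M (compress (on_site s D)).
  move=> cM; have [c ->] := pauli_mx_span D.
  have cZ a p : comm_mx M (compress (a *: on_site s (pauli_mx R p))).
    by rewrite -scalemxAr -scalemxAl; apply: comm_mxZ.
  have cD X Y : comm_mx M (compress X) -> comm_mx M (compress Y) ->
      comm_mx M (compress (X + Y)).
    by move=> MX MY; rewrite mulmxDr mulmxDl; apply: comm_mxD.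
  by rewrite !on_siteD !on_siteZ; do 3![apply: (cD); first exact: cZ]; exact: cZ.
by apply: (span) => q; apply: comm_mx_sym; apply: span => p;
  apply: compress_pauli_comm.
Qed.

End Compression.

(** * Simultaneous recurrence of phases *)

Section UnitCircle.
Variable R : realType.
Local Notation C := R[i].
Local Notation cos := (@trigo.cos R).
Local Notation sin := (@trigo.sin R).
Local Notation pi := (@trigo.pi R).

Definition expi (t : R) : C := Complex (cos t) (sin t).

Lemma expiD x y : expi (x + y) = expi x * expi y.
Proof. by rewrite /expi trigo.cosD trigo.sinD; simpc; rewrite [sin x * _ + _]addrC. Qed.

Lemma expi0 : expi 0 = 1.
Proof. by rewrite /expi trigo.cos0 trigo.sin0. Qed.

Lemma expiMn x m : expi (x *+ m) = expi x ^+ m.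
Proof. by elim: m => [|m IHm]; rewrite ?mulr0n ?expi0 // mulrS expiD IHm exprS. Qed.

Lemma expi_sum (I : Type) (r : seq I) (F : I -> R) :
  expi (\sum_(j <- r) F j) = \prod_(j <- r) expi (F j).
Proof. exact: (big_morph expi expiD expi0). Qed.

Lemma expi_conj x : (expi x)^* = expi (- x).
Proof. by rewrite /expi trigo.cosN trigo.sinN. Qed.

Lemma expi_surj (z : C) : z * z^* = 1 -> exists t, z = expi t.
Proof.
case: z => a b; rewrite -[_^*]/(Complex a (- b)); simpc => /eqP.
rewrite eq_complex /= => /andP[/eqP ab1 _].
have a1 : a ^+ 2 <= 1 by rewrite -ab1 !expr2 lerDl -expr2 sqr_ge0.
have a11 : -1 <= a <= 1.
  by rewrite -ler_norml -(@ler_pXn2r _ 2) ?nnegrE // expr1n real_normK ?num_real.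
have sb : sin (trigo.acos a) = `|b|.
  by rewrite trigo.sin_acos // -ab1 !expr2 [X in Num.sqrt X](_ : _ = b ^+ 2) ?sqrtr_sqr //; ring.
have ca : cos (trigo.acos a) = a by rewrite trigo.acosK.
have [b0|b0] := leP 0 b.
  by exists (trigo.acos a); rewrite /expi ca sb ger0_norm.
exists (- trigo.acos a).
by rewrite /expi trigo.cosN trigo.sinN ca sb ltr0_norm ?opprK.
Qed.

Lemma expi_2pi_int (z : int) : expi (z%:~R * (pi *+ 2)) = 1.
Proof.
have nat m : expi (m%:R * (pi *+ 2)) = 1.
  by rewrite mulr_natl expiMn /expi trigo.cos2pi trigo.sin2pi expr1n.
case: z => m; first exact: nat.
by rewrite NegzE mulrNz mulNr -expi_conj pmulrn nat conjC1.
Qed.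

(** [1 - cos t] is twice the square of [sin (|t| / 2)], which is positive for [|t| / 2] strictly
    between 0 and pi. *)
Lemma expi_eq1 t : expi t = 1 -> `|t| < pi *+ 2 -> t = 0.
Proof.
move=> [cost1 _] lt_t; apply: contra_eq cost1 => t0.
have /trigo.sin_gt0_pi s0 : 0 < `|t| / 2 < pi.
  by rewrite divr_gt0 ?normr_gt0 //= ltr_pdivrMr // mulr_natr.
have half : `|t| = (`|t| / 2) *+ 2 by rewrite -mulr_natr divfK ?pnatr_eq0.
rewrite -trigo.cos_norm half trigo.cos_mulr2n trigo.cos2sin2 -subr_eq0.
rewrite [X in X != 0](_ : _ = - (2 * (sin (`|t| / 2)) ^+ 2)); last by ring.
by rewrite oppr_eq0 mulf_eq0 negb_or pnatr_eq0 expf_neq0 // lt0r_neq0.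
Qed.

(** Pigeonhole: for [a] from 0 to [N ^ n], the points whose coordinates are the fractional parts of
    [a * t j] lie in [N ^ n] cubes of side [1 / N]. Two share a cube, and [m] is the difference of
    their indices. The bound on [m] does not depend on [t]. *)
Lemma dirichlet_simultaneous n N (t : 'I_n -> R) : (0 < N)%N ->
  exists2 m, (0 < m <= N ^ n)%N &
    exists z : 'I_n -> int, forall j, `|m%:R * t j - (z j)%:~R| < N%:R^-1.
Proof.
case: N => // N _.
pose frac (x : R) := x - (Num.floor x)%:~R.
have fracP x : 0 <= frac x < 1.
  have /andP[lo hi] := real_floor_itv (num_real x).
  by rewrite subr_ge0 lo ltrBlDl; move: hi; rewrite intrD.
pose g (a : 'I_(N.+1 ^ n).+1) : {ffun 'I_n -> 'I_N.+1} :=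
  [ffun j => inord (Num.truncn (N.+1%:R * frac (a%:R * t j)))].
have /injectivePn[a [b neq_ab eq_g]] : ~~ injectiveb g.
  apply/injectiveP => /leq_card; rewrite card_ffun !card_ord.
  by rewrite ltnn.
wlog lt_ab : a b neq_ab eq_g / (a < b)%N.
  move=> wl; have := neq_ab; rewrite -val_eqE neq_ltn => /orP[lt_ab|lt_ba].
    exact: (wl a b).
  by apply: (wl b a) => //; rewrite eq_sym.
exists (b - a)%N.
  by rewrite subn_gt0 lt_ab /= leq_subLR (leq_trans _ (leq_addl _ _)) // -ltnS.
exists (fun j => Num.floor (b%:R * t j) - Num.floor (a%:R * t j)) => j.
have N0 : 0 < N.+1%:R :> R by rewrite ltr0n.
have box x : (Num.truncn (N.+1%:R * frac x))%:R <= N.+1%:R * frac x <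
    (Num.truncn (N.+1%:R * frac x)).+1%:R /\ (Num.truncn (N.+1%:R * frac x) < N.+1)%N.
  have /andP[f0 f1] := fracP x.
  have Nf0 : 0 <= N.+1%:R * frac x by rewrite mulr_ge0 ?ler0n.
  by rewrite truncn_itv // truncn_lt_nat // gtr_pMr.
have [] := box (b%:R * t j); have [] := box (a%:R * t j).
have /(congr1 val) := congr1 (fun f : {ffun _ -> _} => f j) eq_g.
rewrite !ffunE /= => eq_tr bxa lta bxb ltb; rewrite !inordK // in eq_tr.
rewrite -eq_tr in bxb.
have -> : (b - a)%:R * t j - (Num.floor (b%:R * t j) - Num.floor (a%:R * t j))%:~R =
    frac (b%:R * t j) - frac (a%:R * t j).
  by rewrite natrB ?(ltnW lt_ab) // intrB /frac; ring.
rewrite -(@ltr_pM2l _ N.+1%:R) // -{1}(gtr0_norm N0) -normrM mulfV ?lt0r_neq0 //.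
move: bxa bxb; rewrite -[(Num.truncn _).+1%:R]natr1 ltr_norml => /andP[a1 a2] /andP[b1 b2].
by apply/andP; split; lra.
Qed.

Lemma simultaneous_recurrence n (u : 'I_n -> C) : (forall j, u j * (u j)^* = 1) ->
  exists2 m, (0 < m <= n.+1 ^ n)%N &
    exists phi : 'I_n -> R, (forall j, u j ^+ m = expi (phi j)) /\
      \sum_j `|phi j| < pi *+ 2.
Proof.
move=> u1.
have pi2 : 0 < pi *+ 2 by rewrite mulrn_wgt0 ?trigo.pi_gt0.
have /choice[th thP] : forall j, exists t, u j = expi t.
  by move=> j; apply: expi_surj.
(* With n + 1 for [N], the n errors add up to at most n / (n + 1) of a full turn, hence to less than
   2 pi. *)
have [m m_le [z zP]] := dirichlet_simultaneous (fun j => th j / (pi *+ 2)) (ltn0Sn n).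
exists m => //; exists (fun j => (m%:R * (th j / (pi *+ 2)) - (z j)%:~R) * (pi *+ 2)).
split=> [j|].
  rewrite mulrBl expiD -mulNr -mulrNz expi_2pi_int mulr1 mulrA mulfVK ?lt0r_neq0 //.
  by rewrite mulr_natl expiMn -thP.
apply: (@le_lt_trans _ _ (\sum_(j < n) n.+1%:R^-1 * (pi *+ 2))).
  apply: ler_sum => j _; rewrite normrM (gtr0_norm pi2).
  by rewrite ler_pM2r // ltW.
rewrite sumr_const card_ord -mulrnAl -mulr_natl gtr_pMl //.
by rewrite ltr_pdivrMr ?ltr0n // mul1r ltr_nat.
Qed.

End UnitCircle.

(** * Powers of automorphisms *)

Lemma finGroup_exponent (gT : finGroupType) :
  exists2 N, (0 < N)%N & forall x : gT, (x ^+ N = 1)%g.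
Proof.
exists #|[set: gT]%G|; first by rewrite cardG_gt0.
by move=> x; rewrite expg_cardG ?inE.
Qed.

Section LocalUnitaries.
Local Open Scope sesquilinear_scope.
Variable R : realType.
Local Notation C := R[i].

Lemma tens_diag n (D : 'I_n -> 'rV[C]_2) :
  tens (fun j => diag_mx (D j)) = diag_mx (\row_a \prod_j D j 0 (label a j)).
Proof.
apply/matrixP => a b; rewrite !mxE; have [->|ne] := eqVneq a b.
  by rewrite mulr1n; apply: eq_bigr => j _; rewrite mxE eqxx mulr1n.
have [j nej] : exists j, label a j != label b j.
  apply/existsP; rewrite -negb_forall; apply: contra_neqN ne => /forallP h.
  by apply: label_inj; apply/ffunP => j; apply/eqP.
by rewrite (bigD1 j) //= mxE (negbTE nej) mulr0n mul0r.
Qed.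

Lemma on_site_diag n (j : 'I_n) (v : 'rV[C]_2) :
  on_site j (diag_mx v) = diag_mx (\row_a v 0 (label a j)).
Proof.
pose D i : 'rV[C]_2 := if i == j then v else const_mx 1.
rewrite /on_site (@eq_tens _ _ _ (fun i => diag_mx (D i))) => [|i].
  rewrite tens_diag; congr diag_mx; apply/rowP => a.
  rewrite !mxE (bigD1 j) //= /D eqxx big1 ?mulr1 // => i /negbTE->.
  by rewrite mxE.
by rewrite /D; case: (i == j) => //; rewrite diag_const_mx.
Qed.

Lemma on_site_conj n (j : 'I_n) (T : 'I_n -> 'M[C]_2) (M : 'M[C]_2) :
  (forall i, T i \is unitarymx) ->
  (tens T)^t* *m on_site j M *m tens T = on_site j ((T j)^t* *m M *m T j).
Proof.
move=> uT; rewrite tens_adj !tens_mul; apply: eq_tens => i.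
by have [->|_] := eqVneq i j; rewrite ?mulmx1 ?unitary_adj_mul.
Qed.

(* The power is a scalar times exp(iH), where H is the sum and has spectrum of diameter
   less than 2 pi; hence it has the same commutant as H. *)
Lemma local_unitary_log n (U : 'I_n -> 'M[C]_2) : (forall j, U j \is unitarymx) ->
  exists2 m, (0 < m <= n.+1 ^ n)%N & exists B : 'I_n -> 'M[C]_2,
    forall M, comm_mx M (tens U ^+ m) <-> comm_mx M (\sum_j on_site j (B j)).
Proof.
move=> uU.
have /choice[TD TDP] : forall j, exists TD : 'M[C]_2 * 'rV[C]_2,
    [/\ TD.1 \is unitarymx, U j = TD.1^t* *m diag_mx TD.2 *m TD.1
      & forall x, TD.2 0 x * (TD.2 0 x)^* = 1].
  by move=> j; have [T [D h]] := unitary_spectral (uU j); exists (T, D).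
pose T j := (TD j).1; pose D j := (TD j).2.
have uT j : T j \is unitarymx by have [] := TDP j.
have D1 j x : D j 0 x * (D j 0 x)^* = 1 by have [] := TDP j.
(* The recurrence is applied to the ratio of the two eigenvalues of each factor; the eigenvalue at
   index 0 goes into the overall scalar [c]. *)
have [m m_le [phi [phiP phi_lt]]] : exists2 m, (0 < m <= n.+1 ^ n)%N &
    exists phi : 'I_n -> R, (forall j, (D j 0 1 * (D j 0 0)^*) ^+ m = expi (phi j)) /\
      \sum_j `|phi j| < trigo.pi *+ 2.
  apply: simultaneous_recurrence => j.
  by rewrite rmorphM /= conjCK mulrACA D1 mul1r mulrC D1.
exists m => //.
(* The generator on site [j] has eigenvalues 0 and [phi j]. *)
pose v j : 'rV[C]_2 := \row_x (phi j *+ x)%:C%C.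
exists (fun j => (T j)^t* *m diag_mx (v j) *m T j).
have eqU : tens U ^+ m =
    (tens T)^t* *m diag_mx (\row_a (\prod_j D j 0 (label a j)) ^+ m) *m tens T.
  have -> : tens U = (tens T)^t* *m diag_mx (\row_a \prod_j D j 0 (label a j)) *m tens T.
    rewrite -tens_diag tens_adj !tens_mul; apply: eq_tens => j.
    by have [] := TDP j.
  have -> : \row_a (\prod_j D j 0 (label a j)) ^+ m =
      \row_a ((\row_b \prod_j D j 0 (label b j)) 0 a ^+ m) :> 'rV[C]_(qdim n).
    by apply/rowP => a; rewrite !mxE.
  rewrite conjmx_exp ?diag_mx_exp //.
  - exact/unitarymxP/tens_unitary.
  - exact/unitary_adj_mul/tens_unitary.
pose h (a : 'I_(qdim n)) := \sum_j phi j *+ label a j.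
have -> : \sum_j on_site j ((T j)^t* *m diag_mx (v j) *m T j) =
    (tens T)^t* *m diag_mx (\row_a (h a)%:C%C) *m tens T.
  under eq_bigr do rewrite -on_site_conj // on_site_diag.
  rewrite -mulmx_suml -mulmx_sumr; congr (_ *m _ *m _).
  rewrite -raddf_sum; congr diag_mx; apply/rowP => a.
  by rewrite summxE mxE rmorph_sum; apply: eq_bigr => j _; rewrite !mxE.
rewrite eqU; set lam := \row_a _ ^+ m; set hh := \row_a _%:C%C.
pose c := \prod_j D j 0 0 ^+ m.
have lamE a : lam 0 a = c * expi (h a).
  rewrite mxE -prodrXl expi_sum -big_split; apply: eq_bigr => j _ /=.
  move: (label a j); apply: ord2P; first by rewrite mulr0n expi0 mulr1.
  rewrite mulr1n -phiP -exprMn; congr (_ ^+ _).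
  by rewrite mulrCA D1 mulr1.
have c0 : c != 0.
  apply/prodf_neq0 => j _; rewrite expf_neq0 //.
  by apply: contra_eq_neq (D1 j 0) => ->; rewrite mul0r eq_sym oner_neq0.
have uTT : tens T \is unitarymx by apply: tens_unitary.
(* Two values of [h] differ by at most the sum of the [|phi j|], hence by less than 2 pi, so the
   exponential separates them. *)
have lam_h a b : lam 0 a = lam 0 b <-> hh 0 a = hh 0 b.
  rewrite !lamE ![hh _ _]mxE; split=> [/(mulfI c0) eq_e|/complexI -> //].
  congr (_%:C%C); apply/eqP; rewrite -subr_eq0; apply/eqP/expi_eq1.
    by rewrite expiD eq_e -expiD subrr expi0.
  apply: le_lt_trans phi_lt; rewrite /h -sumrB.
  apply: le_trans (ler_norm_sum _ _ _) _; apply: ler_sum => j _.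
  move: (label a j) (label b j); apply: ord2P; apply: ord2P => /=;
    by rewrite ?mulr0n ?mulr1n ?subrr ?subr0 ?sub0r ?normrN ?normr0.
by move=> M; split; apply: commutant_diag => // a b /lam_h.
Qed.

(** The shape of an automorphism, kept apart from its commutation with the code projector. *)
Definition permuted_local n (V : 'M[C]_(qdim n)) : Prop :=
  exists (pi : 'S_n) (U : 'I_n -> 'M[C]_2),
    (forall j, U j \is unitarymx) /\ V = permute_qubits R pi *m tens U.

Lemma permuted_local1 n : permuted_local (1%:M : 'M[C]_(qdim n)).
Proof.
exists 1%g, (fun _ => 1%:M); split.
  by move=> j; apply/unitarymxP; rewrite adj1 mulmx1.
by rewrite permute_qubits1 tens1 mulmx1.
Qed.

(** Moving a local unitary past a permutation only relabels its sites. The permutation of the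
    product stays explicit so that it can be tracked through powers. *)
Lemma permuted_local_mul_with n (p q : 'S_n) (U U' : 'I_n -> 'M[C]_2) :
  (forall j, U j \is unitarymx) -> (forall j, U' j \is unitarymx) ->
  exists2 U'' : 'I_n -> 'M[C]_2, (forall j, U'' j \is unitarymx) &
    (permute_qubits R p *m tens U) *m (permute_qubits R q *m tens U') =
    permute_qubits R (p * q)%g *m tens U''.
Proof.
move=> uU uU'; exists (fun j => U (q^-1 j)%g *m U' j).
  by move=> j; apply: mul_unitarymx.
rewrite -tens_mul -permute_qubitsM !mulmxA; congr (_ *m _).
by rewrite -!mulmxA tens_permute.
Qed.

Lemma permuted_localM n (A B : 'M[C]_(qdim n)) :
  permuted_local A -> permuted_local B -> permuted_local (A *m B).
Proof.
move=> [p [U [uU ->]]] [q [U' [uU' ->]]].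
have [U'' uU'' ->] := permuted_local_mul_with p q uU uU'.
by exists (p * q)%g, U''.
Qed.

(** An exponent of the symmetric group kills the permutation part of every [V] at once. *)
Lemma permuted_local_exp n : exists2 N, (0 < N)%N &
  forall V : 'M[C]_(qdim n), permuted_local V ->
  exists2 U : 'I_n -> 'M[C]_2, (forall j, U j \is unitarymx) & V ^+ N = tens U.
Proof.
have [N N0 NP] := finGroup_exponent 'S_n.
exists N => // V [p [U [uU ->]]].
suff [W uW ->] : exists2 W : 'I_n -> 'M[C]_2, (forall j, W j \is unitarymx) &
    (permute_qubits R p *m tens U) ^+ N = permute_qubits R (p ^+ N)%g *m tens W.
  by exists W; rewrite // NP permute_qubits1 mul1mx.
elim: N {N0 NP} => [|m [W uW IHm]].
  exists (fun _ => 1%:M); last by rewrite tens1 mulmx1 expr0 expg0 permute_qubits1.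
  by move=> j; apply/unitarymxP; rewrite adj1 mulmx1.
have [W' uW' eqW'] := permuted_local_mul_with p (p ^+ m)%g uU uW.
by exists W'; rewrite // exprS IHm -mulmxE eqW' expgS.
Qed.

End LocalUnitaries.

(** * A common exponent for all automorphisms *)

Section AutomorphismPowers.
Variables (R : realType) (n k : nat) (S : set 'M[R[i]]_(qdim n)).
Hypotheses (hS : stabilizer S) (le_kn : (k <= n)%N).
Hypothesis hcard : (S #= `I_(2 ^ (n - k)))%card.
Hypothesis hfree : free_of_trivially_encoded_qubits S.
Local Notation C := R[i].
Local Notation P := (code_projector S).

(** Suitable powers have the commutants of sums of one-site operators, whose compressions commute
    term by term; [comm_compress] carries this back to the powers. *)
Lemma local_recurrence_comm (U U' : 'I_n -> 'M[C]_2) :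
  (forall j, U j \is unitarymx) -> (forall j, U' j \is unitarymx) ->
  comm_mx P (tens U) -> comm_mx P (tens U') ->
  exists m m', [/\ (0 < m <= n.+1 ^ n)%N, (0 < m' <= n.+1 ^ n)%N
    & comm_mx (tens U ^+ m *m P) (tens U' ^+ m' *m P)].
Proof.
move=> uU uU' PU PU'.
have [m m_le [B UB]] := local_unitary_log uU.
have [m' m'_le [B' UB']] := local_unitary_log uU'.
exists m, m'; split=> //.
apply: (comm_compress (code_projector_idem hS le_kn hcard) UB UB').
- exact: commrX.
- exact: commrX.
rewrite !mulmx_sumr !mulmx_suml; apply: comm_mx_sum => j _.
apply/comm_mx_sym/comm_mx_sum => i _.
exact: (compress_on_site_comm hS le_kn hcard hfree).
Qed.

Lemma expr_mul_projector (V : 'M[C]_(qdim n)) m : comm_mx P V -> (0 < m)%N ->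
  (V *m P) ^+ m = V ^+ m *m P.
Proof.
move=> PV; elim: m => // -[|m] IHm _; first by rewrite !expr1.
rewrite exprSr IHm // -mulmxE -mulmxA (mulmxA P) PV -(mulmxA V).
by rewrite (code_projector_idem hS le_kn hcard) mulmxA [in RHS]exprSr mulmxE.
Qed.

Lemma automorphism_power_comm : exists2 q, (0 < q)%N &
  forall V V' : 'M[C]_(qdim n), permuted_local V -> permuted_local V' ->
  comm_mx P V -> comm_mx P V' -> comm_mx ((V *m P) ^+ q) ((V' *m P) ^+ q).
Proof.
have [N N0 NP] := permuted_local_exp R n.
(* The recurrence exponents vary with [V] and [V'] but are bounded, so all of them divide the
   factorial. *)
exists (N * (n.+1 ^ n)`!)%N; first by rewrite muln_gt0 N0 fact_gt0.
move=> V V' lV lV' PV PV'.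
have [U uU eU] := NP _ lV; have [U' uU' eU'] := NP _ lV'.
have [m [m' [m_le m'_le]]] : exists m m', [/\ (0 < m <= n.+1 ^ n)%N, (0 < m' <= n.+1 ^ n)%N
    & comm_mx (tens U ^+ m *m P) (tens U' ^+ m' *m P)].
  by apply: local_recurrence_comm; rewrite // -?eU -?eU'; apply: commrX.
have /andP[m0 _] := m_le; have /andP[m'0 _] := m'_le.
have [Nm0 Nm'0] : (0 < N * m)%N /\ (0 < N * m')%N by rewrite !muln_gt0 N0.
rewrite -eU -eU' -(exprM V) -(exprM V').
rewrite -(expr_mul_projector PV Nm0) -(expr_mul_projector PV' Nm'0) => cVV'.
have pow_div l : (0 < l <= n.+1 ^ n)%N -> exists r, (N * (n.+1 ^ n)`! = N * l * r)%N.
  by move=> /dvdn_fact/dvdnP[r ->]; exists r; rewrite -mulnA (mulnC r).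
have [r er] := pow_div _ m_le; have [r' er'] := pow_div _ m'_le.
rewrite {1}er er' !(exprM _ (_ * _)).
by apply: commrX; apply: commr_sym; apply: commrX; apply: commr_sym.
Qed.

End AutomorphismPowers.

(** * Approximation in operator norm *)

Section OperatorNorm.
Variable R : realType.
Local Notation C := R[i].
Local Notation normc := (@Normc.normc R).

Lemma normc_ge0 (z : C) : 0 <= normc z.
Proof. by case: z => a b; rewrite /normc sqrtr_ge0. Qed.

Lemma normc_sum (I : Type) (r : seq I) (F : I -> C) :
  normc (\sum_(j <- r) F j) <= \sum_(j <- r) normc (F j).
Proof.
elim: r => [|j r IHr]; first by rewrite !big_nil Normc.normc0.
by rewrite !big_cons; apply: le_trans (le_normcD _ _) _; rewrite lerD2l.
Qed.

(** The entrywise norm is elementary to estimate, and it is at most [d * d] times the operator norm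
    in dimension [d]. *)
Definition norm1 m n (A : 'M[C]_(m, n)) : R := \sum_a \sum_b normc (A a b).

Lemma norm1_ge0 m n (A : 'M[C]_(m, n)) : 0 <= norm1 A.
Proof. by apply: sumr_ge0 => a _; apply: sumr_ge0 => b _; apply: normc_ge0. Qed.

Lemma norm1_eq0 m n (A : 'M[C]_(m, n)) : norm1 A = 0 -> A = 0.
Proof.
move/eqP; rewrite psumr_eq0 => [/allP A0|a _]; last first.
  by apply: sumr_ge0 => b _; apply: normc_ge0.
apply/matrixP => a b; have := A0 a (mem_index_enum _); rewrite /= psumr_eq0.
  by move=> /allP/(_ b (mem_index_enum _)) /= /eqP/Normc.eq0_normc ->; rewrite mxE.
by move=> c _; apply: normc_ge0.
Qed.

Lemma norm1D m n (A B : 'M[C]_(m, n)) : norm1 (A + B) <= norm1 A + norm1 B.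
Proof.
rewrite -big_split; apply: ler_sum => a _; rewrite -big_split; apply: ler_sum => b _.
by rewrite mxE; apply: le_normcD.
Qed.

Lemma norm1N m n (A : 'M[C]_(m, n)) : norm1 (- A) = norm1 A.
Proof. by apply: eq_bigr => a _; apply: eq_bigr => b _; rewrite mxE normcN. Qed.

Lemma norm1M m n p (A : 'M[C]_(m, n)) (B : 'M[C]_(n, p)) :
  norm1 (A *m B) <= norm1 A * norm1 B.
Proof.
rewrite mulr_suml; apply: ler_sum => a _.
apply: (@le_trans _ _ (\sum_b \sum_c normc (A a c) * normc (B c b))).
  apply: ler_sum => b _; rewrite mxE; apply: le_trans (normc_sum _ _) _.
  by apply: ler_sum => c _; rewrite Normc.normcM.
rewrite exchange_big mulr_suml; apply: ler_sum => c _ /=.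
rewrite -mulr_sumr ler_wpM2l ?normc_ge0 //.
rewrite /norm1 (bigD1 c) //= lerDl; apply: sumr_ge0 => d _; apply: sumr_ge0 => b _.
exact: normc_ge0.
Qed.

Lemma mulmx_cont d (A A' : 'M[C]_d) (e : R) : 0 < e -> exists2 del : R, 0 < del &
  forall B B' : 'M[C]_d, norm1 (A - B) < del -> norm1 (A' - B') < del ->
    norm1 (A *m A' - B *m B') < e.
Proof.
move=> e0; pose c := norm1 A + norm1 A' + 1.
have [nA nA'] := (norm1_ge0 A, norm1_ge0 A').
have c0 : 0 < c by rewrite /c; lra.
exists (Num.min 1 (e / c)); first by rewrite lt_min ltr01 divr_gt0.
move=> B B'; rewrite !lt_min !ltr_pdivlMr // => /andP[x1 xe] /andP[y1 ye].
have -> : A *m A' - B *m B' =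
    (A - B) *m A' + A *m (A' - B') - (A - B) *m (A' - B').
  by rewrite !mulmxBr !mulmxBl; apply/matrixP => i j; rewrite !mxE; ring.
have [nx ny] := (norm1_ge0 (A - B), norm1_ge0 (A' - B')).
apply: le_lt_trans (norm1D _ _) _; rewrite norm1N.
apply: le_lt_trans (lerD (norm1D _ _) (norm1M _ _)) _.
apply: le_lt_trans (lerD (lerD (norm1M _ _) (norm1M _ _)) (lexx _)) _.
move: nA nA' nx ny x1 xe y1 ye; rewrite /c {c c0}.
move: (norm1 (A - B)) (norm1 (A' - B')) (norm1 A) (norm1 A') => x y a b.
move=> a0 b0 x0 y0 x1 xe y1 ye.
(* Since [x] and [y] are below 1, [x b + a y + x y] is at most the larger of them times
   [a + b + 1]. *)
have [le_xy|lt_yx] := leP x y.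
  have : 0 <= (y - x) * b by rewrite mulr_ge0 // subr_ge0.
  have : 0 <= y * (1 - x) by rewrite mulr_ge0 // subr_ge0 ltW.
  lra.
have : 0 <= (x - y) * a by rewrite mulr_ge0 // subr_ge0 ltW.
have : 0 <= x * (1 - y) by rewrite mulr_ge0 // subr_ge0 ltW.
lra.
Qed.

Lemma exprmx_cont d (A : 'M[C]_d) q (e : R) : 0 < e -> exists2 del : R, 0 < del &
  forall B : 'M[C]_d, norm1 (A - B) < del -> norm1 (A ^+ q - B ^+ q) < e.
Proof.
elim: q e => [|q IHq] e e0.
  exists 1 => // B _; rewrite !expr0 subrr.
  suff -> : norm1 (0 : 'M[C]_d) = 0 by [].
  by rewrite /norm1 big1 // => a _; rewrite big1 // => b _; rewrite mxE Normc.normc0.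
have [del del0 hdel] := mulmx_cont A (A ^+ q) e0.
have [del' del'0 hdel'] := IHq _ del0.
exists (Num.min del del'); first by rewrite lt_min del0.
by move=> B; rewrite lt_min => /andP[lt1 lt2]; rewrite !exprS; apply: hdel => //; apply: hdel'.
Qed.

(** A nonzero commutator [M] of the powers would differ from the vanishing commutator of close
    approximants by less than its own norm, each of the two products contributing less than half. *)
Lemma comm_exp_limit d (A A' : 'M[C]_d) q :
  (forall del : R, 0 < del -> exists B B' : 'M[C]_d,
     [/\ norm1 (A - B) < del, norm1 (A' - B') < del & comm_mx (B ^+ q) (B' ^+ q)]) ->
  comm_mx (A ^+ q) (A' ^+ q).
Proof.
move=> approx; apply/eqP; rewrite -subr_eq0; apply/eqP/norm1_eq0.
set M := _ - _; apply/eqP/negPn/negP => M0.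
have M_gt0 : 0 < norm1 M / 2 by rewrite divr_gt0 // lt_def M0 norm1_ge0.
have [d1 d10 h1] := mulmx_cont (A ^+ q) (A' ^+ q) M_gt0.
have [d2 d20 h2] := mulmx_cont (A' ^+ q) (A ^+ q) M_gt0.
have cont2 (X : 'M[C]_d) : exists2 del : R, 0 < del & forall B : 'M[C]_d, norm1 (X - B) < del ->
    norm1 (X ^+ q - B ^+ q) < d1 /\ norm1 (X ^+ q - B ^+ q) < d2.
  have [d3 d30 h3] := exprmx_cont X q d10.
  have [d4 d40 h4] := exprmx_cont X q d20.
  exists (Num.min d3 d4); first by rewrite lt_min d30.
  by move=> B; rewrite lt_min => /andP[/h3 ? /h4].
have [d3 d30 h3] := cont2 A; have [d4 d40 h4] := cont2 A'.
have min_gt0 : 0 < Num.min d3 d4 by rewrite lt_min d30.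
have [B [B' [ltB ltB' cBB']]] := approx _ min_gt0.
have [a1 a2] : norm1 (A ^+ q - B ^+ q) < d1 /\ norm1 (A ^+ q - B ^+ q) < d2.
  by apply: h3; apply: lt_le_trans ltB _; rewrite ge_min lexx.
have [b1 b2] : norm1 (A' ^+ q - B' ^+ q) < d1 /\ norm1 (A' ^+ q - B' ^+ q) < d2.
  by apply: h4; apply: lt_le_trans ltB' _; rewrite ge_min lexx orbT.
pose X := A ^+ q *m A' ^+ q - B ^+ q *m B' ^+ q.
pose Y := A' ^+ q *m A ^+ q - B' ^+ q *m B ^+ q.
have eM : M = X - Y by rewrite /M /X /Y cBB' opprB addrA subrK.
have ltX : norm1 X < norm1 M / 2 := h1 _ _ a1 b1.
have ltY : norm1 Y < norm1 M / 2 := h2 _ _ b2 a2.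
clearbody X Y M; rewrite -(norm1N Y) in ltY.
by have := le_lt_trans (norm1D X (- Y)) (ltrD ltX ltY); rewrite -eM -splitr ltxx.
Qed.

Lemma normc_le_ket_norm d (psi : 'cV[C]_d) a : normc (psi a 0) <= ket_norm psi.
Proof.
rewrite -[leLHS]ger0_norm ?normc_ge0 // -sqrtr_sqr ler_wsqrtr // (bigD1 a) //= lerDl.
by apply: sumr_ge0 => b _; rewrite sqr_ge0.
Qed.

Lemma normc_le_op_norm d (M : 'M[C]_d) a b : normc (M a b) <= op_norm M.
Proof.
pose e : 'cV[C]_d := delta_mx b 0.
have -> : M a b = (M *m e) a 0 by rewrite -colE mxE.
apply: le_trans (normc_le_ket_norm _ _) _; apply: ub_le_sup; last first.
  exists e => //=; rewrite /ket_norm (bigD1 b) //= big1 => [|c /negbTE nc].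
    by rewrite mxE !eqxx addr0 Normc.normc1 expr1n sqrtr1.
  by rewrite mxE nc Normc.normc0 expr0n.
(* The supremum bounds its set only if that set is bounded: on the unit ball each coordinate of the
   image is at most a row sum of moduli. *)
exists (Num.sqrt (\sum_c (\sum_j normc (M c j)) ^+ 2)) => _ [psi /= psi1 <-].
rewrite /ket_norm ler_wsqrtr //; apply: ler_sum => c _.
rewrite ler_pXn2r ?nnegrE ?normc_ge0 //; last first.
  by apply: sumr_ge0 => j _; apply: normc_ge0.
rewrite mxE; apply: le_trans (normc_sum _ _) _; apply: ler_sum => j _.
rewrite Normc.normcM ler_piMr ?normc_ge0 //.
exact: le_trans (normc_le_ket_norm _ _) psi1.
Qed.

Lemma norm1_le_op_norm d (M : 'M[C]_d) : norm1 M <= op_norm M *+ (d * d).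
Proof.
rewrite mulrnA -[X in _ *+ X]card_ord -sumr_const; apply: ler_sum => a _.
rewrite -[X in _ *+ X]card_ord -sumr_const; apply: ler_sum => b _.
exact: normc_le_op_norm.
Qed.

End OperatorNorm.

(** * Encoded single-qubit gates *)

Section Gates.
Local Open Scope sesquilinear_scope.
Variable R : realType.
Local Notation C := R[i].

(** The gate exp(i t Z). *)
Definition phase_gate (t : R) : 'M[C]_2 := diag_mx (\row_x expi (if x == 0 then t else - t)).

Lemma phase_gateD x y : phase_gate (x + y) = phase_gate x *m phase_gate y.
Proof.
rewrite mulmx_diag; congr diag_mx; apply/rowP; apply: ord2P;
  by rewrite !mxE -?opprD /= -expiD ?opprD.
Qed.

Lemma phase_gate_adj t : (phase_gate t)^t* = phase_gate (- t).
Proof.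
apply: matrix2P; rewrite !mxE /= ?mulr1n ?mulr0n ?expi_conj ?conjC0 //.
Qed.

Lemma phase_gate0 : phase_gate 0 = 1%:M.
Proof.
by rewrite -diag_const_mx; congr diag_mx; apply/rowP; apply: ord2P; rewrite !mxE /= ?oppr0 expi0.
Qed.

Lemma phase_gate_unitary t : phase_gate t \is unitarymx.
Proof. by apply/unitarymxP; rewrite phase_gate_adj -phase_gateD subrr phase_gate0. Qed.

Lemma phase_gateMn t m : phase_gate (t *+ m) = phase_gate t ^+ m.
Proof. by elim: m => [|m IHm]; rewrite ?mulr0n ?phase_gate0 // mulrS phase_gateD IHm exprS. Qed.

Lemma phase_gate_flip t : pauli_mx R PX *m phase_gate t *m pauli_mx R PX = phase_gate (- t).
Proof.
by apply: matrix2P; rewrite !mxE !sum_ord2 !mxE !sum_ord2 !mxE /= ?mulr1n ?mulr0n ?opprK;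
  ring.
Qed.

(** Conjugation by X inverts the phase gate, so its commutator with X is its square. *)
Lemma phase_gate_commutator t :
  phase_gate (t + t) = unitary_commutator (phase_gate t) (pauli_mx R PX).
Proof.
rewrite /unitary_commutator pauli_mx_adj phase_gate_adj -!mulmxA (mulmxA (pauli_mx R PX)).
by rewrite phase_gate_flip opprK phase_gateD.
Qed.

(** The 3-4-5 triangle gives a real rotation with rational entries. *)
Definition rotation : 'M[C]_2 :=
  \matrix_(i, j) (if i == j then 3 / 5 else if i == 0 then 4 / 5 else - (4 / 5)).

Lemma rotation_unitary : rotation \is unitarymx.
Proof.
apply/unitarymxP; apply: matrix2P; rewrite !mxE !sum_ord2 !mxE /=
  ?rmorphN ?rmorphM ?fmorphV ?rmorph_nat /=; by field.
Qed.

Lemma phase_gate_rotation_ncomm :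
  ~ comm_mx (phase_gate (trigo.pi / 2))
      (rotation *m phase_gate (trigo.pi / 2) *m rotation^t*).
Proof.
move/matrixP/(_ 0 1).
rewrite !mxE !sum_ord2 !mxE !sum_ord2 !mxE !sum_ord2 !mxE /=.
have c3 : (3 / 5)^* = 3 / 5 :> C by rewrite rmorphM fmorphV !rmorph_nat.
have c4 : (4 / 5)^* = 4 / 5 :> C by rewrite rmorphM fmorphV !rmorph_nat.
rewrite rmorphN /= c3 c4 !mulr1n !mulr0n.
have ab : expi (trigo.pi / 2) - expi (- (trigo.pi / 2)) != 0 :> C.
  rewrite /expi trigo.cosN trigo.sinN trigo.cos_pihalf trigo.sin_pihalf; simpc.
  by rewrite eq_complex /= negb_and -mulr2n pnatr_eq0 orbT.
move: (expi _) (expi _) ab => a b ab eq_ab; case/negP: ab; rewrite -sqrf_eq0.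
move/eqP: eq_ab; rewrite -subr_eq0 => /eqP eq0.
(* The entry at 0, 1 of the commutator is -12/25 times the square of [a - b]. *)
rewrite -[X in X == 0](_ : - (25 / 12) * 0 = _); first by rewrite mulr0.
by rewrite -eq0; field.
Qed.

Lemma noncommuting_commutators q : (0 < q)%N -> exists A B A' B' : 'M[C]_2,
  [/\ A \is unitarymx, B \is unitarymx, A' \is unitarymx, B' \is unitarymx
    & ~ comm_mx (unitary_commutator A B ^+ q) (unitary_commutator A' B' ^+ q)].
Proof.
(* The commutator doubles the angle and the power multiplies it by [q], so the [q]-th power is the
   phase gate of angle pi / 2. The second pair is the first one conjugated by [rotation]. *)
move=> q_gt0; pose t : R := trigo.pi / 4 / q%:R.
have uX := pauli_mx_unitary R PX; have uD := phase_gate_unitary t.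
have uT := rotation_unitary; have TT := unitary_adj_mul uT.
have uTs : rotation^t* \is unitarymx by rewrite (trmxC_unitary rotation).
have ucj A : A \is unitarymx -> rotation *m A *m rotation^t* \is unitarymx.
  by move=> uA; exact: mul_unitarymx (mul_unitarymx uT uA) uTs.
exists (phase_gate t), (pauli_mx R PX), (rotation *m phase_gate t *m rotation^t*),
  (rotation *m pauli_mx R PX *m rotation^t*).
split; [exact: uD | exact: uX | exact: ucj uD | exact: ucj uX |].
rewrite -(unitary_commutator_conj _ _ TT) -phase_gate_commutator.
have -> : (rotation *m phase_gate (t + t) *m rotation^t*) ^+ q =
    rotation *m phase_gate (t + t) ^+ q *m rotation^t*.
  by have /unitarymxP TT' := uT; apply: (conjmx_exp _ q TT TT').
have -> : phase_gate (t + t) ^+ q = phase_gate (trigo.pi / 2).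
  rewrite -phase_gateMn; congr phase_gate; rewrite /t -mulr_natr; field.
  by rewrite pnatr_eq0 -lt0n.
exact: phase_gate_rotation_ncomm.
Qed.

End Gates.

(** * Gates on one logical qubit, extended to the whole space *)

Section LogicalGates.
Local Open Scope sesquilinear_scope.
Variables (R : realType) (n k : nat) (S : set 'M[R[i]]_(qdim n)).
Hypotheses (hS : stabilizer S) (le_kn : (k <= n)%N).
Hypothesis hcard : (S #= `I_(2 ^ (n - k)))%card.
Variables Xb Zb : 'I_k -> 'M[R[i]]_(qdim n).
Variable E : 'M[R[i]]_(qdim n, qdim k).
Hypotheses (hE : logical_encoding S Xb Zb E) (EE : E *m E^t* = code_projector S).
Variable s : 'I_k.
Local Notation C := R[i].
Local Notation P := (code_projector S).

(** Being the identity on the orthogonal complement of the code space makes the extension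
    multiplicative and compatible with adjoints. *)
Definition encoded_gate (W : 'M[C]_2) : 'M[C]_(qdim n) :=
  E *m on_site s W *m E^t* + (1%:M - P).

Lemma encoding_adj_mul : E^t* *m E = 1%:M.
Proof. by have [] := hE. Qed.

Lemma code_projector_encoding : P *m E = E.
Proof. by rewrite -EE -mulmxA encoding_adj_mul mulmx1. Qed.

Lemma encoded_gate_encoding W : encoded_gate W *m E = E *m on_site s W.
Proof.
rewrite mulmxDl mulmxBl mul1mx code_projector_encoding subrr addr0.
by rewrite -mulmxA encoding_adj_mul mulmx1.
Qed.

Lemma encoded_gate_projector W : encoded_gate W *m P = E *m on_site s W *m E^t*.
Proof. by rewrite -EE mulmxA encoded_gate_encoding. Qed.

Lemma projector_encoded_gate W : P *m encoded_gate W = E *m on_site s W *m E^t*.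
Proof.
rewrite mulmxDr mulmxBr mulmx1 (code_projector_idem hS le_kn hcard) subrr addr0.
by rewrite !mulmxA code_projector_encoding.
Qed.

Lemma encoded_gateM A B : encoded_gate (A *m B) = encoded_gate A *m encoded_gate B.
Proof.
rewrite {3}/encoded_gate mulmxDr mulmxBr mulmx1 !mulmxA encoded_gate_encoding.
rewrite encoded_gate_projector /encoded_gate -on_site_mul mulmxA.
by rewrite [E *m on_site s A *m _ + _]addrC addrK.
Qed.

Lemma encoded_gate_adj A : (encoded_gate A)^t* = encoded_gate (A^t*).
Proof.
have [_ aP _] := code_projectorP hS le_kn hcard.
have -> : encoded_gate A = E *m on_site s A *m E^t* - (P - 1%:M) by rewrite opprB.
by rewrite !adjB !adj_mul trmxCK aP adj1 on_site_adj opprB mulmxA.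
Qed.

Lemma encoded_gate1 : encoded_gate 1%:M = 1%:M.
Proof. by rewrite /encoded_gate on_site1 mulmx1 EE addrC subrK. Qed.

Lemma encoded_gate_unitary A : A \is unitarymx -> encoded_gate A \is unitarymx.
Proof.
move=> /unitarymxP AA; apply/unitarymxP.
by rewrite encoded_gate_adj -encoded_gateM AA encoded_gate1.
Qed.

Lemma encoded_gate_commutator A B :
  encoded_gate (unitary_commutator A B) =
  unitary_commutator (encoded_gate A) (encoded_gate B).
Proof.
by rewrite /unitary_commutator !encoded_gateM -!encoded_gate_adj.
Qed.

Lemma special_unitary_commutator d (A B : 'M[C]_d) :
  A \is unitarymx -> B \is unitarymx -> special_unitary (unitary_commutator A B).
Proof.
by move=> uA uB; split; [exact: unitary_commutator_unitary uA uB |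
  exact: det_unitary_commutator uA uB].
Qed.

(* Restricting to commutators W avoids computing the determinant of an encoded gate. *)
Lemma encoded_commutator A B : A \is unitarymx -> B \is unitarymx ->
  let W := unitary_commutator A B in
  [/\ logical_gates S (encoded_gate W), special_unitary W
    & acts_on_logical_qubit S Xb Zb s (encoded_gate W) W].
Proof.
move=> uA uB /=; split.
- split; last by rewrite encoded_gate_projector projector_encoded_gate.
  rewrite encoded_gate_commutator.
  exact: special_unitary_commutator (encoded_gate_unitary uA) (encoded_gate_unitary uB).
- exact: special_unitary_commutator uA uB.
- by exists E; [exact: hE | exact: encoded_gate_encoding].
Qed.

Lemma encoded_gate_exp W q : (0 < q)%N ->
  (encoded_gate W *m P) ^+ q = E *m on_site s (W ^+ q) *m E^t*.
Proof.
rewrite encoded_gate_projector; elim: q => // -[|q] IHq _; first by rewrite !expr1.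
rewrite exprS IHq // [W ^+ q.+2]exprS -!mulmxE -on_site_mul.
by rewrite !mulmxA -(mulmxA (E *m _)) encoding_adj_mul mulmx1.
Qed.

(** The isometry [E] is undone by its adjoint, and [on_site s] is injective. *)
Lemma comm_encoded A B :
  comm_mx (E *m on_site s A *m E^t*) (E *m on_site s B *m E^t*) -> comm_mx A B.
Proof.
have mulE X Y : (E *m on_site s X *m E^t*) *m (E *m on_site s Y *m E^t*) =
    E *m on_site s (X *m Y) *m E^t*.
  by rewrite -on_site_mul !mulmxA -(mulmxA (E *m _)) encoding_adj_mul mulmx1.
rewrite /comm_mx !mulE => /(congr1 (fun M => E^t* *m M *m E)).
have cancelE M : E^t* *m (E *m M *m E^t*) *m E = M.
  by rewrite !mulmxA encoding_adj_mul mul1mx -mulmxA encoding_adj_mul mulmx1.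
by rewrite !cancelE => /on_site_inj.
Qed.

Lemma comm_encoded_gate_exp A B q : (0 < q)%N ->
  comm_mx ((encoded_gate A *m P) ^+ q) ((encoded_gate B *m P) ^+ q) ->
  comm_mx (A ^+ q) (B ^+ q).
Proof.
move=> q_gt0; rewrite [X in comm_mx X _](encoded_gate_exp A q_gt0).
by rewrite [X in comm_mx _ X](encoded_gate_exp B q_gt0); apply: comm_encoded.
Qed.

End LogicalGates.

(** * Failure of universality *)

Lemma prod_permuted_local (R : realType) (n : nat) (P : 'M[R[i]]_(qdim n)) eta
    (V : 'I_eta -> 'M[R[i]]_(qdim n)) :
  (forall l, permuted_local (V l) /\ comm_mx P (V l)) ->
  permuted_local (\big[mulmx/1%:M]_(l < eta) V l) /\
  comm_mx P (\big[mulmx/1%:M]_(l < eta) V l).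
Proof.
move=> hV; apply: (big_ind (fun A => permuted_local A /\ comm_mx P A)) => //.
  by split; [exact: permuted_local1 | exact: comm_mx1].
move=> A B [lA cA] [lB cB]; split; first exact: permuted_localM.
exact: comm_mxM.
Qed.

Theorem theorem3 (R : realType) (n k : nat) (S : set 'M[R[i]]_(qdim n))
    (hS : stabilizer S)
    (hk : (1 <= k <= n)%N)
    (hcard : (S #= `I_(2 ^ (n - k)))%card)
    (hfree : free_of_trivially_encoded_qubits S)
    (Xb Zb : 'I_k -> 'M[R[i]]_(qdim n))
    (hL : logical_paulis S Xb Zb)
    (s : 'I_k) :
  ~ encoded_computationally_universal S Xb Zb s (automorphism_group S).
Proof.
case=> _ univ; have /andP[_ le_kn] := hk.
have [E [hE EE]] := logical_encoding_exists hS le_kn hcard hL.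
have [q q_gt0 comm_q] := automorphism_power_comm hS le_kn hcard hfree.
pose P := code_projector S.
have approx A B : A \is unitarymx -> B \is unitarymx -> forall del : R, 0 < del ->
    exists V, [/\ permuted_local V, comm_mx P V &
      norm1 (encoded_gate S E s (unitary_commutator A B) *m P - V *m P) < del].
  move=> uA uB del del_gt0.
  have [gW sW aW] := encoded_commutator hS le_kn hcard hE EE s uA uB.
  have d_gt0 : 0 < (qdim n * qdim n)%:R :> R by rewrite ltr0n muln_gt0 qdimE expn_gt0.
  (* The tolerance is divided by the squared dimension, the factor lost between the operator norm
     and [norm1]. *)
  have [eta [V [hV ltV]]] := univ _ _ gW sW aW _ (divr_gt0 del_gt0 d_gt0).
  have [lV cV] : permuted_local (\big[mulmx/1%:M]_(l < eta) V l) /\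
      comm_mx P (\big[mulmx/1%:M]_(l < eta) V l).
    by apply: prod_permuted_local => l; have [[_ cVl] lVl] := hV l.
  exists (\big[mulmx/1%:M]_(l < eta) V l); split=> //.
  apply: le_lt_trans (norm1_le_op_norm _) _.
  by rewrite -mulr_natr -ltr_pdivlMr.
have [A [B [A' [B' [uA uB uA' uB' ncomm]]]]] := noncommuting_commutators R q_gt0.
apply: ncomm; apply: (comm_encoded_gate_exp hE EE q_gt0).
(* The two encoded commutators are limits of operators [V *m P] and [V' *m P] whose [q]-th powers
   commute, so their own [q]-th powers would commute. *)
apply: comm_exp_limit => del del_gt0.
have [V [lV cV ltV]] := approx _ _ uA uB _ del_gt0.
have [V' [lV' cV' ltV']] := approx _ _ uA' uB' _ del_gt0.
by exists (V *m P), (V' *m P); split; [exact: ltV | exact: ltV' | exact: comm_q].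
Qed.
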